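(* Let $m\le d$, let $\Omega\subset\mathbb{R}^d$ be open, and let $h=(h_1,\dots,h_m)^T:\mathbb{R}^d\to\mathbb{R}^m$ be continuously differentiable and Lipschitz, with $j_h(x):=\sqrt{\det(J_h(x)J_h(x)^T)}>0$ for all $x\in\Omega$. Let $P$ be a finite measure on $\Omega$ with density $p:\Omega\to[0,\infty)$ (measurable) with respect to Lebesgue measure on $\mathbb{R}^d$. Define $$v(y):=\int_{\Omega\cap h^{-1}(y)}\frac{p(x)}{j_h(x)}\,d\mathcal{H}^{d-m}(x),\qquad y\in\mathbb{R}^m,$$ (so $v(y)=0$ if $y\notin h(\Omega)$). Then the measure $V(dy)=v(y)\,dy$ on $\mathbb{R}^m$ is the pushforward $h_\#P$ of $P$ by the mapping $h$. In particular, if $\int_\Omega j_h(x)\,dx<+\infty$, then for the reference measure $P(dx):=j_h(x)\,dx$ on $\Omega$, $$V(dy)=\mathcal{H}^{d-m}(\Omega\cap h^{-1}(y))\,dy .$$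
   Context: $J_h(x)\in\mathbb{R}^{m\times d}$ denotes the Jacobian matrix of $h$ at $x$. $\mathcal{H}^{d-m}$ is the $(d-m)$-dimensional Hausdorff measure on $\mathbb{R}^d$, normalized so that it coincides with Lebesgue measure on $(d-m)$-dimensional affine subspaces (and is counting measure when $m=d$), i.e. with the normalization for which Federer's coarea formula $\int_{\Omega} g\,j_h\,dx=\int_{\mathbb{R}^m}\int_{\Omega\cap h^{-1}(y)}g\,d\mathcal{H}^{d-m}\,dy$ is valid. The pushforward is $h_\#P(A)=P(\{x\in\Omega: h(x)\in A\})$ for Borel $A\subset\mathbb{R}^m$. The function $v$ may take the value $+\infty$ on a Lebesgue-null set. *)

(* Defs.v *)
From HB Require Import structures.
From mathcomp Require Import all_boot all_order all_algebra.
From mathcomp Require Import all_classical all_reals all_analysis.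
From mathcomp Require Import measurable_realfun.

Set Implicit Arguments.
Unset Strict Implicit.
Unset Printing Implicit Defensive.

Import Order.TTheory GRing.Theory Num.Theory.
Import numFieldNormedType.Exports.

Local Open Scope classical_set_scope.
Local Open Scope ring_scope.

(* Vectors of R^n are row vectors 'rV[R]_n. *)

Definition borelRV (R : realType) (n : nat) := g_sigma_algebraType (@open 'rV[R]_n).

(* Lebesgue measure on R^n. On Borel sets it is the n-fold product of the
   one-dimensional Lebesgue measure, transported along R * R^n ~ R^(1 + n). *)

Definition consRV (R : realType) (n : nat)
    (tx : measurableTypeR R * borelRV R n) : borelRV R n.+1 :=
  row_mx (const_mx tx.1 : 'rV[R]_1) (tx.2 : 'rV[R]_n).

Lemma ratr_rV_near (R : realType) (n : nat) (x : 'rV[R]_n) (e : R) : 0 < e ->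
  exists q : 'rV[rat]_n, ball (map_mx ratr q : 'rV[R]_n) e x.
Proof.
move=> e0.
have H (j : 'I_n) : exists q : rat, `|ratr q - x ord0 j| < e.
  have /rat_in_itvoo[q] : x ord0 j - e < x ord0 j + e.
    by rewrite ltrBlDr -addrA ltrDl addr_gt0.
  by rewrite in_itv/= => /andP[q1 q2]; exists q; rewrite ltr_distl q1 q2.
have [f Hf] := choice H.
exists (\row_j f j); split => // i j; rewrite ord1 !mxE.
exact: Hf.
Qed.

Lemma measurable_consRV (R : realType) (n : nat) :
  measurable_fun setT (@consRV R n).
Proof.
apply: (@measurability _ _ _ (borelRV R n.+1) setT (@consRV R n) (@open _) erefl) => _ [U oU <-]; rewrite setTI.
pose box (q : rat * 'rV[rat]_n * nat) : set (measurableTypeR R * borelRV R n) :=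
  ball (ratr q.1.1 : R) q.2.+1%:R^-1 `*`
  (ball (map_mx ratr q.1.2 : 'rV[R]_n) q.2.+1%:R^-1 : set 'rV[R]_n).
have mbox q : measurable (box q).
  apply: measurableX.
    by apply: open_measurable; apply: ball_open.
  by apply: sub_sigma_algebra; apply: ball_open.
pose W := @consRV R n @^-1` U.
rewrite (_ : _ @^-1` _ = \bigcup_(q in [set q | box q `<=` W]) box q); last first.
  apply/seteqP; split => [[t x] /= Utx|tx [q /= qW]]; last exact: qW.
  have /nbhs_ballP[e /= e0 eU] : nbhs (consRV (t, x) : 'rV[R]_n.+1) U.
    exact: open_nbhs_nbhs.
  have [k ke] : exists k, k.+1%:R^-1 < e / 2.
    have e20 : 0 < e / 2 by rewrite divr_gt0.
    exists (Num.truncn (e / 2)^-1); rewrite invf_plt ?posrE// ?invr_gt0//.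
    exact: truncnS_gt.
  have k0 : (0 : R) < k.+1%:R^-1 by rewrite invr_gt0.
  have /rat_in_itvoo[q0] : t - k.+1%:R^-1 < t + k.+1%:R^-1.
    by rewrite ltrBlDr -addrA ltrDl addr_gt0.
  rewrite in_itv/= => /andP[q1 q2].
  have q0t : ball (ratr q0 : R) k.+1%:R^-1 t.
    by rewrite /ball/= ltr_distl q1 q2.
  have [q qx] := ratr_rV_near x k0.
  exists ((q0, q), k) => //= -[s y] /= [/= sq yq]; apply: eU.
  have ee : k.+1%:R^-1 + k.+1%:R^-1 <= e by rewrite (splitr e) lerD// ltW.
  have ts : ball (t : R) e (s : R).
    by apply: (le_ball ee); apply: ball_triangle (ball_sym q0t) sq.
  have [_ xy] : @mx_ball 1 n R R x e y.
    by apply: (le_ball ee); apply: ball_triangle (ball_sym qx) yq.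
  split => // i j; rewrite !mxE /=.
  by case: (fintype.split (j : 'I_(1 + n))) => a; rewrite ?mxE.
rewrite bigcup_mkcond; apply: countable_bigcupT_measurable => // q.
by case: ifPn.
Qed.

Section pushforward_consRV.
Context (R : realType) (n : nat).
Variable mu : {measure set (measurableTypeR R * borelRV R n) -> \bar R}.

Let pushforward_consRV (A : set (borelRV R n.+1)) : \bar R :=
  pushforward mu (@consRV R n) A.

Let mcons := @measurable_consRV R n.

Let map0 : pushforward_consRV set0 = 0%E. Proof. exact: measure0. Qed.

Let map_ge0 A : (0 <= pushforward_consRV A)%E. Proof. exact: measure_ge0. Qed.

Let map_sigma_additive : semi_sigma_additive pushforward_consRV.
Proof. exact: measure_semi_sigma_additive. Qed.

HB.instance Definition _ := isMeasure.Build _ _ _ pushforward_consRV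
  map0 map_ge0 map_sigma_additive.

Definition measure_consRV : {measure set (borelRV R n.+1) -> \bar R} :=
  pushforward_consRV.

End pushforward_consRV.

Fixpoint borel_lebesgue (R : realType) (n : nat) :
    {measure set (borelRV R n) -> \bar R} :=
  if n is n'.+1 return {measure set (borelRV R n) -> \bar R} then
    measure_consRV (@lebesgue_measure R \x^ borel_lebesgue R n')%E
  else @dirac _ (borelRV R 0) (0 : 'rV[R]_0) R.

(* R^n with the Lebesgue (completed) sigma-algebra. *)
Definition lebesgueRV (R : realType) (n : nat) :=
  @caratheodory_type R (borelRV R n) (mu_ext (borel_lebesgue R n)).

HB.instance Definition _ (R : realType) (n : nat) :=
  Measurable.on (lebesgueRV R n).

Definition lebesgue_rV (R : realType) (n : nat) :
    {measure set (lebesgueRV R n) -> \bar R} :=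
  @completed_measure_extension _ _ R (borel_lebesgue R n).

(* Hausdorff measures, for the Euclidean distance: the norm `|x| that the
   library puts on 'rV[R]_n is the sup norm, hence the explicit Euclidean norm. *)

Definition euclid_norm (R : realType) (n : nat) (x : 'rV[R]_n) : R :=
  Num.sqrt (\sum_(i < n) x ord0 i ^+ 2).

Definition diameter (R : realType) (n : nat) (A : set 'rV[R]_n) : \bar R :=
  ereal_sup [set (euclid_norm (xy.1 - xy.2))%:E | xy in A `*` A].

(* For k = 0 every nonempty set has weight 1, so that one gets the counting
   measure. *)
Definition hausdorff_weight (R : realType) (n k : nat) (A : set 'rV[R]_n) :
    \bar R :=
  if A == set0 then 0%E else (diameter A ^+ k)%E.

Definition hausdorff_pre (R : realType) (n k : nat) (delta : R)
    (A : set 'rV[R]_n) : \bar R :=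
  ereal_inf [set (\sum_(i <oo) hausdorff_weight k (F i))%E |
    F in [set F : (set 'rV[R]_n)^nat |
      A `<=` \bigcup_i F i /\ forall i, (diameter (F i) <= delta%:E)%E]].

Definition hausdorff_unnormalized (R : realType) (n k : nat)
    (A : set 'rV[R]_n) : \bar R :=
  ereal_sup [set hausdorff_pre k delta A | delta in [set delta : R | 0 < delta]].

Definition unit_cube (R : realType) (k : nat) : set 'rV[R]_k :=
  [set x | forall i, 0 <= x ord0 i <= 1].

(* The factor making the k-dimensional Hausdorff measure of the unit cube of
   R^k equal to 1, i.e. making H^k and Lebesgue measure agree on R^k. *)
Definition hausdorff_factor (R : realType) (k : nat) : R :=
  (fine (hausdorff_unnormalized k (@unit_cube R k)))^-1.

Definition hausdorff (R : realType) (n k : nat) (A : set 'rV[R]_n) : \bar R :=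
  ((hausdorff_factor R k)%:E * hausdorff_unnormalized k A)%E.

Section hausdorff_outer_measure.
Context (R : realType) (n k : nat).
Implicit Types (A B : set 'rV[R]_n) (F : (set 'rV[R]_n)^nat) (delta : R).
Local Open Scope ereal_scope.

Lemma diameter_ge0 A : A !=set0 -> 0 <= diameter A.
Proof.
move=> [x Ax]; apply: ereal_sup_ge; exists (euclid_norm (x - x))%:E.
  by exists (x, x).
by rewrite lee_fin sqrtr_ge0.
Qed.

Lemma hausdorff_weight_ge0 A : 0 <= hausdorff_weight k A.
Proof.
rewrite /hausdorff_weight; case: eqVneq => // /set0P A0.
by rewrite expe_ge0// diameter_ge0.
Qed.

Lemma hausdorff_weight0 : hausdorff_weight k (@set0 'rV[R]_n) = 0.
Proof. by rewrite /hausdorff_weight eqxx. Qed.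

Let weight delta A : \bar R :=
  if diameter A <= delta%:E then hausdorff_weight k A else +oo.

Let weight_ge0 delta A : 0 <= weight delta A.
Proof. by rewrite /weight; case: ifP => // _; exact: hausdorff_weight_ge0. Qed.

Let weight0 delta : weight delta set0 = 0.
Proof.
by rewrite /weight hausdorff_weight0 /diameter setX0 image_set0 ereal_sup0 leNye.
Qed.

Let mu_ext_weight delta : set 'rV[R]_n -> \bar R :=
  @mu_ext _ (g_sigma_algebraType [set: set 'rV[R]_n]) R (weight delta).

Let hausdorff_preE delta : @hausdorff_pre R n k delta = mu_ext_weight delta.
Proof.
apply/funext => A; apply/eqP; rewrite eq_le; apply/andP; split.
  apply: le_ereal_inf_tmp => _ [F [_ AF] <-].
  have [Fd|] := pselect (forall i, diameter (F i) <= delta%:E).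
    apply: ereal_inf_lbound; exists F => //.
    by apply: eq_eseriesr => i _; rewrite /weight Fd.
  move=> /existsNP[i /negP Fi]; rewrite (@eseries_pinfty _ _ xpredT i) ?leey//.
  - by move=> j _; rewrite -ltNye (lt_le_trans _ (weight_ge0 _ _)).
  - by rewrite /weight (negbTE Fi).
apply: le_ereal_inf_tmp => _ [F [AF Fd] <-].
apply: ereal_inf_lbound; exists F.
  by split => // i; exact: sub_sigma_algebra.
by apply: eq_eseriesr => i _; rewrite /weight Fd.
Qed.

Lemma hausdorff_pre0 delta : hausdorff_pre k delta (@set0 'rV[R]_n) = 0.
Proof. by rewrite hausdorff_preE /mu_ext_weight mu_ext0. Qed.

Lemma hausdorff_pre_ge0 delta A : 0 <= hausdorff_pre k delta A.
Proof. by rewrite hausdorff_preE /mu_ext_weight mu_ext_ge0. Qed.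

Lemma le_hausdorff_pre delta :
  {homo (@hausdorff_pre R n k delta) : A B / A `<=` B >-> A <= B}.
Proof.
rewrite hausdorff_preE => A B.
exact: (@le_mu_ext _ (g_sigma_algebraType [set: set 'rV[R]_n]) R (weight delta)).
Qed.

Lemma hausdorff_pre_sigma_subadditive delta :
  sigma_subadditive (@hausdorff_pre R n k delta).
Proof.
rewrite hausdorff_preE.
apply: (@mu_ext_sigma_subadditive _ (g_sigma_algebraType [set: set 'rV[R]_n])).
exact: weight_ge0.
Qed.

Lemma hausdorff_unnormalized_ge0 A : 0 <= hausdorff_unnormalized k A.
Proof.
apply: ereal_sup_ge; exists (hausdorff_pre k 1 A); last exact: hausdorff_pre_ge0.
by exists 1%R => //=.
Qed.

End hausdorff_outer_measure.

Section hausdorff_measure.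
Context (R : realType) (n k : nat).
Local Open Scope ereal_scope.

Lemma hausdorff_factor_ge0 : 0 <= (hausdorff_factor R k)%:E.
Proof. by rewrite lee_fin invr_ge0 fine_ge0// hausdorff_unnormalized_ge0. Qed.

Let hausdorff0 : hausdorff k (@set0 'rV[R]_n) = 0.
Proof.
rewrite /hausdorff (_ : hausdorff_unnormalized _ _ = 0) ?mule0//.
apply/eqP; rewrite eq_le hausdorff_unnormalized_ge0 andbT.
by apply: ge_ereal_sup => _ [delta _ <-]; rewrite hausdorff_pre0.
Qed.

Let hausdorff_ge0 (A : set 'rV[R]_n) : 0 <= hausdorff k A.
Proof.
by rewrite mule_ge0 ?hausdorff_factor_ge0 ?hausdorff_unnormalized_ge0.
Qed.

Let le_hausdorff :
  {homo (@hausdorff R n k) : A B / A `<=` B >-> A <= B}.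
Proof.
move=> A B AB; apply: lee_wpmul2l; first exact: hausdorff_factor_ge0.
apply: ge_ereal_sup => _ [delta d0 <-]; apply: ereal_sup_ge.
by exists (hausdorff_pre k delta B); [exists delta | exact: le_hausdorff_pre].
Qed.

Let hausdorff_sigma_subadditive : sigma_subadditive (@hausdorff R n k).
Proof.
move=> F; rewrite nneseriesZl//; last first.
  by move=> *; exact: hausdorff_unnormalized_ge0.
apply: lee_wpmul2l; first exact: hausdorff_factor_ge0.
apply: ge_ereal_sup => _ [delta d0 <-].
apply: (le_trans (hausdorff_pre_sigma_subadditive _ _ _)).
apply: lee_nneseries => i _; first by move=> *; exact: hausdorff_pre_ge0.
by apply: ereal_sup_ubound; exists delta.
Qed.

HB.instance Definition _ := isOuterMeasure.Build R 'rV[R]_n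
  (@hausdorff R n k) hausdorff0 hausdorff_ge0 le_hausdorff
  hausdorff_sigma_subadditive.

End hausdorff_measure.

(* R^n with the sigma-algebra of the Caratheodory measurable sets of H^k. *)
Definition hausdorffRV (R : realType) (n k : nat) :=
  caratheodory_type (@hausdorff R n k).

HB.instance Definition _ (R : realType) (n k : nat) :=
  Measurable.on (hausdorffRV R n k).

Definition hausdorff_measure (R : realType) (n k : nat)
    (A : set (hausdorffRV R n k)) : \bar R := @hausdorff R n k A.

HB.instance Definition _ (R : realType) (n k : nat) :=
  isMeasure.Build _ (hausdorffRV R n k) R (@hausdorff_measure R n k)
    (@caratheodory_measure0 _ _ (@hausdorff R n k))
    (@caratheodory_measure_ge0 _ _ (@hausdorff R n k))
    (@caratheodory_measure_sigma_additive _ _ (@hausdorff R n k)).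

Section smooth_maps.
Context (R : realType) (d m : nat).
Implicit Types (h : 'rV[R]_d -> 'rV[R]_m) (x : 'rV[R]_d).

(* The library's jacobian acts on row vectors from the right: it is the
   transpose of the usual m x d matrix. *)
Definition Jmx h x : 'M[R]_(m, d) := (jacobian h x)^T.

Definition jfactor h x : R := Num.sqrt (\det (Jmx h x *m (Jmx h x)^T)).

Definition continuously_differentiable h : Prop :=
  (forall x, differentiable h x) /\ continuous (Jmx h).

End smooth_maps.

Definition fiber_density (R : realType) (d m : nat) (Omega : set 'rV[R]_d)
    (h : 'rV[R]_d -> 'rV[R]_m) (p : 'rV[R]_d -> R) (y : 'rV[R]_m) : \bar R :=
  (\int[@hausdorff_measure R d (d - m)]_(x in Omega `&` h @^-1` [set y])
     (p x / jfactor h x)%:E)%E.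

(* Main.v *)
Require Import Defs.
From HB Require Import structures.
From mathcomp Require Import all_boot all_order all_algebra.
From mathcomp Require Import all_classical all_reals all_analysis.
From mathcomp Require Import measurable_realfun.
From mathcomp Require Import perm.
From mathcomp Require Import ring lra.
Import Order.TTheory GRing.Theory Num.Theory.
Import numFieldNormedType.Exports.
Local Open Scope classical_set_scope.
Local Open Scope ring_scope.

Set Implicit Arguments.
Unset Strict Implicit.
Unset Printing Implicit Defensive.

(** The statement is the coarea formula, applied to [p / j] on the open set of
    regular points of [h], with [j] the Jacobian factor of [h].

    The coarea formula for a continuously differentiable [h] follows from the linear
    case, by approximation.  Write [J] for the jacobian at a regular point [x0] and
    choose [L] with orthonormal columns that are orthogonal to those of [J]
    ([orthonormal_completion]).  Then [M = (J L)] is invertible, and [|det M|] is the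
    Jacobian factor at [x0] ([normr_det_row_mx]).  Let [Phi x = (h x, x L)] and
    [Psi x = Phi x M^-1].  Near [x0] the map [Psi] is a translation up to an
    arbitrarily small relative error, hence changes distances by factors as close to
    [1] as desired ([local_almost_linear]).  Moreover, on a fibre of [h] the distances
    between the points [Psi x] are those between the points [x L].  Consequently, for a
    small Borel set [E] and up to factors close to [1],
    - the [k]-dimensional measure of [E] cut along [h = y] is that of its projection
      by [L], which is the section of [Phi E] at [y];
    - the integral over [y] of the measures of these sections is the Lebesgue measure
      of [Phi E = (Psi E) M], that is [|det M|] times that of [Psi E], and this is
      nearly that of [E].
    This is the coarea formula up to a factor [lam > 1] ([local_coarea_approx]).
    Countably many such sets partition any Borel set of regular points, and both sides
    are countably additive; letting [lam] tend to [1] gives the exact formula, together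
    with the measurability of the measures of the fibres ([coarea_borel_set]).

    It uses the behaviour of Hausdorff measure under Lipschitz maps
    ([hausdorff_lipschitz]), its additivity on Borel sets
    ([borel_hausdorff_measurable]), its equality with Lebesgue measure in the top
    dimension ([hausdorff_leb]), Fubini for [R^m * R^k] ([leb_prod]), and the scaling
    of Lebesgue measure by the determinant ([leb_mulmx_preimage]).  The last three all
    rest on one fact: a translation invariant Borel measure that is finite on the unit
    cube is a multiple of Lebesgue measure ([translation_invariant_unique]).

    Monotone convergence passes from sets to nonnegative Borel functions
    ([ge0_integral_disintegration], [coarea_borel_fun]).  The density [p] is only
    Lebesgue measurable.  It is Borel off a Borel null set [N]
    ([measurable_fun_completion]), and the coarea formula for [N] shows that almost
    every fibre meets [N] in a set of Hausdorff measure zero ([null_set_fibres]); there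
    the integral over the fibre is not affected by [N]. *)

(** * The Euclidean norm *)

Section euclidean_norm.
Variable R : realType.

Lemma euclid_norm_ge0 n (x : 'rV[R]_n) : 0 <= euclid_norm x.
Proof. exact: sqrtr_ge0. Qed.

Lemma sqr_euclid_norm n (x : 'rV[R]_n) : euclid_norm x ^+ 2 = \sum_i x ord0 i ^+ 2.
Proof. by rewrite sqr_sqrtr// sumr_ge0// => i _; exact: sqr_ge0. Qed.

Lemma sqr_euclid_norm_mx n (x : 'rV[R]_n) : euclid_norm x ^+ 2 = (x *m x^T) ord0 ord0.
Proof. by rewrite sqr_euclid_norm mxE; apply: eq_bigr => i _; rewrite mxE expr2. Qed.

Lemma euclid_norm0 n : euclid_norm (0 : 'rV[R]_n) = 0.
Proof.
by rewrite /euclid_norm big1 ?sqrtr0// => i _; rewrite mxE expr0n.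
Qed.

Lemma euclid_norm_le_coord n (x : 'rV[R]_n) i : `|x ord0 i| <= euclid_norm x.
Proof.
rewrite -ler_sqr ?nnegrE ?euclid_norm_ge0// sqr_euclid_norm real_normK ?num_real//.
by rewrite (bigD1 i)//= lerDl sumr_ge0// => j _; exact: sqr_ge0.
Qed.

Lemma euclid_norm_eq0 n (x : 'rV[R]_n) : euclid_norm x = 0 -> x = 0.
Proof.
move=> x0; apply/rowP => i; rewrite mxE; apply/eqP; rewrite -normr_le0 -x0.
exact: euclid_norm_le_coord.
Qed.

Lemma Cauchy_Schwarz n (a b : 'I_n -> R) :
  (\sum_i a i * b i) ^+ 2 <= (\sum_i a i ^+ 2) * (\sum_i b i ^+ 2).
Proof.
set A := \sum_i a i ^+ 2; set B := \sum_i b i ^+ 2; set C := \sum_i a i * b i.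
have B0 : 0 <= B by apply: sumr_ge0 => i _; exact: sqr_ge0.
(* the sum of squares of B a - C b is B (A B - C^2) *)
have H : 0 <= B * (A * B - C ^+ 2).
  have -> : B * (A * B - C ^+ 2) = \sum_i (B * a i - C * b i) ^+ 2.
    transitivity (\sum_i (B ^+ 2 * a i ^+ 2 - B * C *+ 2 * (a i * b i) +
                         C ^+ 2 * b i ^+ 2)); last by apply: eq_bigr => i _; ring.
    rewrite big_split/= big_split/= -!mulr_sumr sumrN -mulr_sumr -/A -/B -/C; ring.
  by apply: sumr_ge0 => i _; exact: sqr_ge0.
have [B_gt0|B_le0] := ltP 0 B.
  by move: H; rewrite pmulr_rge0// subr_ge0.
have B_eq0 : B = 0 by apply/eqP; rewrite eq_le B_le0 B0.
rewrite B_eq0 mulr0 /C big1 ?expr0n// => i _.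
have : b i ^+ 2 = 0.
  apply: (@psumr_eq0P _ _ predT (fun i => b i ^+ 2)) => //= j _; exact: sqr_ge0.
by move/eqP; rewrite sqrf_eq0 => /eqP ->; rewrite mulr0.
Qed.

Lemma ler_euclid_normD n (x y : 'rV[R]_n) :
  euclid_norm (x + y) <= euclid_norm x + euclid_norm y.
Proof.
rewrite -ler_sqr ?nnegrE ?addr_ge0 ?euclid_norm_ge0// sqrrD !sqr_euclid_norm.
have -> : \sum_i (x + y) ord0 i ^+ 2 = \sum_i x ord0 i ^+ 2 +
    (\sum_i x ord0 i * y ord0 i) *+ 2 + \sum_i y ord0 i ^+ 2.
  rewrite -sumrMnl -!big_split/=; apply: eq_bigr => i _; rewrite mxE; ring.
rewrite lerD2r lerD2l lerMn2r/=.
apply: (le_trans (ler_norm _)).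
rewrite -ler_sqr ?nnegrE ?mulr_ge0 ?euclid_norm_ge0// real_normK ?num_real//.
by rewrite exprMn !sqr_euclid_norm Cauchy_Schwarz.
Qed.

Lemma euclid_normZ n a (x : 'rV[R]_n) : euclid_norm (a *: x) = `|a| * euclid_norm x.
Proof.
rewrite -sqrtr_sqr -sqrtrM ?sqr_ge0// mulr_sumr.
by congr Num.sqrt; apply: eq_bigr => i _; rewrite mxE exprMn.
Qed.

Lemma euclid_normN n (x : 'rV[R]_n) : euclid_norm (- x) = euclid_norm x.
Proof. by rewrite -scaleN1r euclid_normZ normrN1 mul1r. Qed.

Lemma euclid_norm_le_sum n (x : 'rV[R]_n) : euclid_norm x <= \sum_i `|x ord0 i|.
Proof.
have S0 : 0 <= \sum_i `|x ord0 i| by exact: sumr_ge0.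
rewrite -ler_sqr ?nnegrE ?euclid_norm_ge0// sqr_euclid_norm [leRHS]expr2 mulr_suml.
apply: ler_sum => i _; rewrite -real_normK ?num_real// expr2 ler_wpM2l//.
by rewrite (bigD1 i)//= lerDl sumr_ge0.
Qed.

Lemma euclid_norm_mulmx_bound n m (M : 'M[R]_(n, m)) :
  exists2 C : R, 0 < C & forall x, euclid_norm (x *m M) <= C * euclid_norm x.
Proof.
have S0 : 0 <= \sum_j \sum_i `|M i j|.
  by apply: sumr_ge0 => j _; exact: sumr_ge0.
exists (1 + \sum_j \sum_i `|M i j|) => [|x]; first by rewrite ltr_pwDl.
apply: le_trans (euclid_norm_le_sum _) _.
apply: (@le_trans _ _ ((\sum_j \sum_i `|M i j|) * euclid_norm x)).
  rewrite mulr_suml; apply: ler_sum => j _; rewrite mxE mulr_suml.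
  apply: (le_trans (ler_norm_sum _ _ _)); apply: ler_sum => i _.
  by rewrite normrM mulrC ler_wpM2l// euclid_norm_le_coord.
by rewrite ler_wpM2r ?euclid_norm_ge0// lerDr.
Qed.

(** The hypothesis says that the columns of [L] are orthonormal. *)
Lemma euclid_norm_mul_orth n k (L : 'M[R]_(n, k)) (z : 'rV[R]_k) :
  L^T *m L = 1%:M -> euclid_norm (z *m L^T) = euclid_norm z.
Proof.
move=> L1; apply/eqP; rewrite -(eqrXn2 (n := 2)) ?euclid_norm_ge0//.
by rewrite !sqr_euclid_norm_mx trmx_mul trmxK mulmxA -(mulmxA z) L1 mulmx1.
Qed.

End euclidean_norm.

(** * Hausdorff measure under Lipschitz maps *)

Section hausdorff_lipschitz.
Variable R : realType.
Local Open Scope ereal_scope.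

Lemma diameter_ubound n (A : set 'rV[R]_n) x y : A x -> A y ->
  (euclid_norm (x - y))%:E <= diameter A.
Proof. by move=> Ax Ay; apply: ereal_sup_ubound; exists (x, y). Qed.

Lemma diameter_le n (A : set 'rV[R]_n) c :
  (forall x y, A x -> A y -> (euclid_norm (x - y) <= c)%R) -> diameter A <= c%:E.
Proof.
by move=> H; apply: ge_ereal_sup => _ [[x y] [Ax Ay] <-]; rewrite lee_fin H.
Qed.

Lemma le_diameter n (A B : set 'rV[R]_n) : A `<=` B -> diameter A <= diameter B.
Proof.
move=> AB; apply: ge_ereal_sup => _ [[x y] [Ax Ay] <-].
by apply: diameter_ubound; exact: AB.
Qed.

Lemma hausdorff_weight_le n k (A : set 'rV[R]_n) c : (0 <= c)%R ->
  diameter A <= c%:E -> hausdorff_weight k A <= (c ^+ k)%:E.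
Proof.
move=> c0 Ac; rewrite /hausdorff_weight; case: eqVneq => [|/set0P A0].
  by rewrite lee_fin exprn_ge0.
have dA0 := diameter_ge0 A0.
have dA : diameter A \is a fin_num.
  by rewrite ge0_fin_numE// (le_lt_trans Ac)// ltry.
rewrite -(fineK dA) -EFin_expe lee_fin lerXn2r ?nnegrE ?fine_ge0//.
by rewrite -lee_fin fineK.
Qed.

Lemma hausdorff_weightE n k (A : set 'rV[R]_n) : A !=set0 ->
  hausdorff_weight k A = diameter A ^+ k.
Proof. by move=> /set0P A0; rewrite /hausdorff_weight (negbTE A0). Qed.

(** A cover [F] of [A] gives the cover of [f A] by the images of the sets [F i] cut by
    [A], whose diameters are at most [lam] times those of [F i]. *)
Lemma hausdorff_pre_lipschitz n n' k (f : 'rV[R]_n -> 'rV[R]_n') (lam delta : R)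
    (A : set 'rV[R]_n) : (0 < lam)%R ->
  (forall x y, A x -> A y -> (euclid_norm (f x - f y) <= lam * euclid_norm (x - y))%R) ->
  hausdorff_pre k (lam * delta) (f @` A) <= (lam ^+ k)%:E * hausdorff_pre k delta A.
Proof.
move=> lam0 flam; rewrite -lee_pdivrMl ?exprn_gt0//.
apply: le_ereal_inf_tmp => _ [F [AF Fd] <-]; rewrite lee_pdivrMl ?exprn_gt0//.
have diamF i : diameter (f @` (F i `&` A)) <= lam%:E * diameter (F i).
  apply: ge_ereal_sup => _ [[_ _] [[x [Fx Ax] <-] [y [Fy Ay] <-]] <-]/=.
  apply: (@le_trans _ _ (lam%:E * (euclid_norm (x - y))%:E)).
    by rewrite -EFinM lee_fin flam.
  by apply: lee_wpmul2l; [rewrite lee_fin ltW|exact: diameter_ubound].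
have lamF i : lam%:E * diameter (F i) <= (lam * delta)%:E.
  by rewrite EFinM lee_wpmul2l// lee_fin ltW.
have wF i : hausdorff_weight k (f @` (F i `&` A)) <=
    (lam ^+ k)%:E * hausdorff_weight k (F i).
  have [FA0|/set0P FA0] := eqVneq (F i `&` A) set0.
    by rewrite FA0 image_set0 hausdorff_weight0 mule_ge0 ?hausdorff_weight_ge0//
      lee_fin exprn_ge0// ltW.
  have F0 : F i !=set0 by case: FA0 => x [Fx _]; exists x.
  have dF0 := diameter_ge0 F0.
  have dF : diameter (F i) \is a fin_num.
    by rewrite ge0_fin_numE// (le_lt_trans (Fd i))// ltry.
  rewrite [in leRHS]hausdorff_weightE// -(fineK dF) -EFin_expe -EFinM -exprMn.
  apply: hausdorff_weight_le; first by rewrite mulr_ge0 ?fine_ge0// ltW.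
  by rewrite EFinM fineK.
rewrite -nneseriesZl; last by move=> *; exact: hausdorff_weight_ge0.
apply: (@le_trans _ _ (\sum_(i <oo) hausdorff_weight k (f @` (F i `&` A)))); last first.
  by apply: lee_nneseries => i *; [exact: hausdorff_weight_ge0|exact: wF].
apply: ereal_inf_lbound; exists (fun i => f @` (F i `&` A)) => //; split.
  by move=> _ [x Ax <-]; have [i _ Fx] := AF _ Ax; exists i => //; exists x.
by move=> i; exact: le_trans (diamF i) (lamF i).
Qed.

Lemma hausdorff_pre_le n k (delta : R) (A : set 'rV[R]_n) : (0 < delta)%R ->
  hausdorff_pre k delta A <= hausdorff_unnormalized k A.
Proof. by move=> d0; apply: ereal_sup_ubound; exists delta. Qed.

Lemma hausdorff_pre_mono n k (d1 d2 : R) (A : set 'rV[R]_n) : (d1 <= d2)%R ->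
  hausdorff_pre k d2 A <= hausdorff_pre k d1 A.
Proof.
move=> d12; apply: le_ereal_inf_tmp => _ [F [AF Fd] <-].
apply: ereal_inf_lbound; exists F => //; split => // i.
by rewrite (le_trans (Fd i))// lee_fin.
Qed.

Lemma hausdorff_lipschitz n n' k (f : 'rV[R]_n -> 'rV[R]_n') (lam : R)
    (A : set 'rV[R]_n) : (0 < lam)%R ->
  (forall x y, A x -> A y -> (euclid_norm (f x - f y) <= lam * euclid_norm (x - y))%R) ->
  hausdorff k (f @` A) <= (lam ^+ k)%:E * hausdorff k A.
Proof.
move=> lam0 flam; rewrite /hausdorff muleCA lee_wpmul2l ?hausdorff_factor_ge0//.
apply: ge_ereal_sup => _ [delta /= d0 <-].
(* delta is lam times delta / lam, and covers at scale delta / lam are at hand *)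
rewrite -(divfK (lt0r_neq0 lam0) delta) mulrC.
apply: le_trans (hausdorff_pre_lipschitz _ _ lam0 flam) _.
apply: lee_wpmul2l; first by rewrite lee_fin exprn_ge0// ltW.
by apply: hausdorff_pre_le; rewrite divr_gt0.
Qed.

(** The inequality makes [f] injective on [A], and its inverse on [f A] is Lipschitz. *)
Lemma hausdorff_expanding n n' k (f : 'rV[R]_n -> 'rV[R]_n') (lam : R)
    (A : set 'rV[R]_n) : (0 < lam)%R ->
  (forall x y, A x -> A y -> (euclid_norm (x - y) <= lam * euclid_norm (f x - f y))%R) ->
  hausdorff k A <= (lam ^+ k)%:E * hausdorff k (f @` A).
Proof.
move=> lam0 flam.
have finj x y : A x -> A y -> f x = f y -> x = y.
  move=> Ax Ay fxy; apply/eqP; rewrite -subr_eq0; apply/eqP/euclid_norm_eq0.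
  apply/eqP; rewrite eq_le euclid_norm_ge0 andbT (le_trans (flam _ _ Ax Ay))//.
  by rewrite fxy subrr euclid_norm0 mulr0.
pose g y := if pselect (exists2 x, A x & f x = y) is left e
            then projT1 (cid2 e) else 0%R.
have gK x : A x -> g (f x) = x.
  move=> Ax; rewrite /g; case: pselect => [e|[]]; last by exists x.
  by case: cid2 => z Az /= fzx; exact: finj.
rewrite [X in hausdorff k X <= _](_ : _ = g @` (f @` A)).
  by apply: hausdorff_lipschitz => // _ _ [x Ax <-] [y Ay <-]; rewrite !gK// flam.
rewrite image_comp; apply/seteqP; split => [x Ax|_ [x Ax <-]/=].
  by exists x => //=; rewrite gK.
by rewrite gK.
Qed.

Lemma hausdorff_isometry n n' k (f : 'rV[R]_n -> 'rV[R]_n') (A : set 'rV[R]_n) :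
  (forall x y, A x -> A y -> euclid_norm (f x - f y) = euclid_norm (x - y)) ->
  hausdorff k (f @` A) = hausdorff k A.
Proof.
move=> fiso; apply/eqP; rewrite eq_le; apply/andP; split.
  rewrite -[leRHS]mul1e -(expr1n _ k); apply: hausdorff_lipschitz => // x y Ax Ay.
  by rewrite mul1r fiso.
rewrite -[leRHS]mul1e -(expr1n _ k); apply: hausdorff_expanding => // x y Ax Ay.
by rewrite mul1r fiso.
Qed.

End hausdorff_lipschitz.

Section hausdorff_metric.
Variable R : realType.
Local Open Scope ereal_scope.

Lemma hausdorff_pre_sep n k (delta gap : R) (A B : set 'rV[R]_n) :
  (delta < gap)%R ->
  (forall x y, A x -> B y -> (gap <= euclid_norm (x - y))%R) ->
  hausdorff_pre k delta A + hausdorff_pre k delta B <= hausdorff_pre k delta (A `|` B).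
Proof.
move=> dg AB; apply: le_ereal_inf_tmp => _ [F [ABF Fd] <-].
(* a set of diameter less than the gap meets at most one of A and B *)
pose meets C i := if pselect (F i `&` C !=set0) then F i else set0.
have meets_sub C i : meets C i `<=` F i.
  by rewrite /meets; case: pselect => ? //; exact: sub0set.
have meets_cover C : C `<=` A `|` B -> C `<=` \bigcup_i meets C i.
  move=> CAB x Cx; have [i _ Fx] := ABF _ (CAB _ Cx); exists i => //.
  by rewrite /meets; case: pselect => // -[]; exists x.
have pre_meets C : C `<=` A `|` B ->
    hausdorff_pre k delta C <= \sum_(i <oo) hausdorff_weight k (meets C i).
  move=> CAB; apply: ereal_inf_lbound; exists (meets C) => //; split.
    exact: meets_cover.
  by move=> i; apply: le_trans (le_diameter (meets_sub C i)) (Fd i).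
apply: (@le_trans _ _ (\sum_(i <oo) hausdorff_weight k (meets A i) +
                       \sum_(i <oo) hausdorff_weight k (meets B i))).
  by apply: leeD; apply: pre_meets => x; [left|right].
rewrite -nneseriesD => [|i _ _|i _ _]; [|exact: hausdorff_weight_ge0..].
apply: lee_nneseries.
  by move=> i _ _; apply: adde_ge0; exact: hausdorff_weight_ge0.
move=> i _; rewrite /meets; case: pselect => [[x [Fx Ax]]|?]; last first.
  rewrite hausdorff_weight0 add0e; case: pselect => ? //.
  by rewrite hausdorff_weight0 hausdorff_weight_ge0.
case: pselect => [[y [Fy By]]|?]; last by rewrite hausdorff_weight0 adde0.
have := le_trans (diameter_ubound Fx Fy) (Fd i); rewrite lee_fin => xyd.
by have := le_lt_trans (le_trans (AB _ _ Ax By) xyd) dg; rewrite ltxx.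
Qed.

(** The premeasures increase as [delta] decreases, so only those [delta] below the gap
    matter, and for them [hausdorff_pre_sep] splits the covers of the union. *)
Lemma hausdorff_unnormalized_sep n k (gap : R) (A B : set 'rV[R]_n) :
  (0 < gap)%R ->
  (forall x y, A x -> B y -> (gap <= euclid_norm (x - y))%R) ->
  hausdorff_unnormalized k A + hausdorff_unnormalized k B <=
  hausdorff_unnormalized k (A `|` B).
Proof.
move=> g0 AB; set H := hausdorff_unnormalized k (A `|` B).
have preH d1 d2 : (0 < d1)%R -> (0 < d2)%R ->
    hausdorff_pre k d1 A + hausdorff_pre k d2 B <= H.
  move=> d10 d20; pose d := Num.min (gap / 2)%R (Num.min d1 d2).
  have d0 : (0 < d)%R by rewrite !lt_min d10 d20 divr_gt0.
  have dg : (d < gap)%R.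
    by rewrite (@le_lt_trans _ _ (gap / 2)%R) ?ge_min ?lexx//; lra.
  apply: le_trans (hausdorff_pre_le _ _ d0).
  apply: le_trans (hausdorff_pre_sep _ dg AB).
  by apply: leeD; apply: hausdorff_pre_mono; rewrite !ge_min lexx ?orbT.
have [->|Hoo] := eqVneq H +oo; first by rewrite leey.
have preA d : (0 < d)%R -> hausdorff_unnormalized k B <= H - hausdorff_pre k d A.
  move=> d0; have Hfin : H \is a fin_num.
    by rewrite ge0_fin_numE ?hausdorff_unnormalized_ge0// ltey.
  have Afin : hausdorff_pre k d A \is a fin_num.
    rewrite ge0_fin_numE ?hausdorff_pre_ge0// (@le_lt_trans _ _ H) ?ltey//.
    by apply: le_trans (preH _ _ d0 d0); rewrite leeDl// hausdorff_pre_ge0.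
  by apply: ge_ereal_sup => _ [d2 /= d20 <-]; rewrite leeBrDl// preH.
have Hfin : H \is a fin_num.
  by rewrite ge0_fin_numE ?hausdorff_unnormalized_ge0// ltey.
have Bfin : hausdorff_unnormalized k B \is a fin_num.
  rewrite ge0_fin_numE ?hausdorff_unnormalized_ge0// (@le_lt_trans _ _ H) ?ltey//.
  apply: ge_ereal_sup => _ [d2 /= d20 <-].
  by apply: le_trans (preH _ _ d20 d20); rewrite leeDr// hausdorff_pre_ge0.
rewrite -leeBrDr//; apply: ge_ereal_sup => _ [d /= d0 <-].
rewrite leeBrDr//; have := preA _ d0.
have Afin : hausdorff_pre k d A \is a fin_num.
  rewrite ge0_fin_numE ?hausdorff_pre_ge0// (@le_lt_trans _ _ H) ?ltey//.
  by apply: le_trans (preH _ _ d0 d0); rewrite leeDl// hausdorff_pre_ge0.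
by rewrite leeBrDl.
Qed.

Lemma hausdorff_sep n k (gap : R) (A B : set 'rV[R]_n) :
  (0 < gap)%R ->
  (forall x y, A x -> B y -> (gap <= euclid_norm (x - y))%R) ->
  hausdorff k A + hausdorff k B <= hausdorff k (A `|` B).
Proof.
move=> g0 AB; rewrite /hausdorff -ge0_muleDr ?hausdorff_unnormalized_ge0//.
by rewrite lee_wpmul2l ?hausdorff_factor_ge0// (hausdorff_unnormalized_sep _ g0).
Qed.

End hausdorff_metric.

(** * Borel sets are Hausdorff measurable *)

Section caratheodory_criterion.
Local Open Scope ereal_scope.

(** The engine of the Caratheodory criterion.  In general an outer measure is not
    continuous along increasing unions; here it is, because a layer
    [A i.+1 minus A i] is separated from the layers two steps away.  The layers of even
    index, and likewise those of odd index, add up to at most [M], so the series of all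
    their measures converges and its tails tend to [0]. *)
Lemma outer_measure_bigcup_layers (R : realType) (T : Type)
    (mu : {outer_measure set T -> \bar R}) (A : (set T)^nat) (M : R) :
  (forall i, A i `<=` A i.+1) -> (forall i, mu (A i) <= M%:E) ->
  (forall i C B, C `<=` A i -> B `<=` A i.+2 `\` A i.+1 ->
     mu C + mu B <= mu (C `|` B)) ->
  mu (\bigcup_i A i) <= M%:E.
Proof.
move=> nA AM sep; pose D i := A i.+1 `\` A i.
have ndA i j : (i <= j)%N -> A i `<=` A j.
  move=> /subnK <-; elim: (j - i)%N => [//|p ih].
  exact: subset_trans ih (nA _).
(* layers of equal parity are pairwise separated, so their masses add up *)
have parity (b : nat) n : \sum_(0 <= j < n) mu (D (j.*2 + b)%N) <=
    mu (\bigcup_(j in `I_n) D (j.*2 + b)%N).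
  elim: n => [|n ih]; first by rewrite big_nil outer_measure_ge0.
  rewrite big_nat_recr//= (le_trans (leeD2r _ ih))//.
  have sub : \bigcup_(j in `I_n) D (j.*2 + b)%N `<=` A (n.*2 + b).-1.
    move=> x [j /= jn [Ax _]]; apply: ndA Ax.
    by rewrite -ltnS; case: n jn {ih} => // n jn; rewrite doubleS !addSn/= !ltnS
      leq_add2r leq_double -ltnS.
  case: n ih sub => [|n] ih sub.
    rewrite bigcup_mkcond bigcup0 ?outer_measure0 ?add0e; last first.
      by move=> i _; case: ifPn => //; rewrite inE.
    by apply: le_outer_measure => x Dx; exists 0%N.
  apply: (le_trans (sep (n.+1.*2 + b).-1 _ _ sub _)).
    by rewrite doubleS !addSn/=.
  apply: le_outer_measure => x [[j jn Dx]|Dx]; first by exists j => //=; exact: ltnW.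
  by exists n.+1 => //=.
have parityM b n : \sum_(0 <= j < n) mu (D (j.*2 + b)%N) <= M%:E.
  apply: le_trans (parity _ _) (le_trans _ (AM (n.*2 + b)%N)).
  apply: le_outer_measure => x [j /= jn [Ax _]]; apply: ndA Ax.
  by rewrite -addSn leq_add2r; apply: leq_trans (_ : j.+1.*2 <= _)%N;
    rewrite ?leq_double// doubleS ltnW.
have sumD n : \sum_(0 <= j < n.*2) mu (D j) =
    \sum_(0 <= j < n) mu (D (j.*2 + 0)%N) + \sum_(0 <= j < n) mu (D (j.*2 + 1)%N).
  elim: n => [|n ih]; first by rewrite !big_nil adde0.
  by rewrite doubleS !big_nat_recr//= ih addn0 addn1 -!addeA; congr (_ + _);
    rewrite addeCA.
have sumDoo : \sum_(0 <= j <oo) mu (D j) < +oo.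
  apply: (@le_lt_trans _ _ (M%:E + M%:E)); last by rewrite -EFinD ltry.
  apply: lime_le; first by apply: is_cvg_nneseries => i _ _; exact: outer_measure_ge0.
  apply: nearW => n; apply: (@le_trans _ _ (\sum_(0 <= j < n.*2) mu (D j))).
    apply: lee_sum_nneg_natr => [i _ _|]; first exact: outer_measure_ge0.
    by rewrite -addnn leq_addr.
  by rewrite sumD leeD// parityM.
have tail := nneseries_tail_cvg sumDoo (fun i _ => outer_measure_ge0 mu (D i)).
apply/lee_addgt0Pr => e e0.
have [N _ Ne] : \forall N \near \oo, \sum_(N <= k <oo) mu (D k) < e%:E.
  by apply: (tail [set x | x < e%:E]); apply: open_ereal_lt'; rewrite lte_fin.
apply: (@le_trans _ _ (mu (A N) + \sum_(N <= k <oo) mu (D k))); last first.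
  by rewrite leeD// ltW// Ne//=.
have cover : \bigcup_i A i `<=` A N `|` \bigcup_i D (i + N)%N.
  move=> x [i _ Ax]; have [ANx|ANx] := pselect (A N x); [by left|right].
  have [j Aj minj] := ex_minnP (ex_intro (fun i => `[< A i x >]) i (asboolT Ax)).
  have Nj : (N < j)%N.
    by rewrite ltnNge; apply/negP => jN; apply: ANx; apply: ndA jN _ (asboolW Aj).
  case: j Aj minj Nj => // j /asboolP Aj minj; rewrite ltnS => Nj.
  exists (j - N)%N => //; rewrite subnK//; split => // /asboolP/minj.
  by rewrite ltnn.
apply: le_trans (le_outer_measure _ _ _ cover) _.
apply: le_trans (outer_measureU2 _ _ _) _; apply: leeD => //.
apply: le_trans (outer_measure_sigma_subadditive _ _) _.
by rewrite (nneseries_addn (f := mu \o D))// => i; exact: outer_measure_ge0.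
Qed.

(** The complement of [F] is exhausted by the sets of points at distance at least
    [1 / (i + 1)] from [F], each of which is separated from [F]. *)
Lemma closed_hausdorff_measurable (R : realType) n k (F : set 'rV[R]_n) :
  closed F -> (@hausdorff R n k).-caratheodory F.
Proof.
move=> cF; apply: le_caratheodory_measurable => X.
change (hausdorff k (X `&` F) + hausdorff k (X `&` ~` F) <= hausdorff k X).
have [->|Xoo] := eqVneq (hausdorff k X) +oo; first by rewrite leey.
have Xfin : hausdorff k X \is a fin_num.
  by rewrite ge0_fin_numE ?(outer_measure_ge0 (@hausdorff R n k))// ltey.
(* the points of X at distance at least 1 / (i + 1) from F *)
pose A i := X `&` [set x | forall f, F f -> (i.+1%:R^-1 <= euclid_norm (x - f))%R].
have XFfin C : C `<=` X -> hausdorff k C \is a fin_num.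
  move=> CX; rewrite ge0_fin_numE ?(outer_measure_ge0 (@hausdorff R n k))//.
  apply: (@le_lt_trans _ _ (hausdorff k X)); last by rewrite ltey.
  exact: (le_outer_measure (@hausdorff R n k)).
have UA : X `&` ~` F = \bigcup_i A i.
  apply/seteqP; split => [x [Xx nFx]|x [i _ [Xx xF]]]; last first.
    split => // /xF; rewrite subrr euclid_norm0 leNgt invr_gt0 ltr0n//.
  have /nbhs_ballP[e /= e0 eF] : nbhs x (~` F).
    by apply: open_nbhs_nbhs; split => //; exact: closed_openC.
  have [i ie] : exists i, (i.+1%:R^-1 < e)%R.
    exists (Num.truncn e^-1); rewrite invf_plt ?posrE// ?invr_gt0//.
    exact: truncnS_gt.
  exists i => //; split => // f Ff; rewrite leNgt; apply/negP => xfi.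
  apply: (eF f) => //; split => // a b; rewrite ord1 /ball/=.
  have := euclid_norm_le_coord (x - f) b; rewrite !mxE => /le_lt_trans; apply.
  exact: lt_trans ie.
rewrite UA -leeBrDl ?XFfin//.
have -> : hausdorff k X - hausdorff k (X `&` F) =
    (fine (hausdorff k X) - fine (hausdorff k (X `&` F)))%:E.
  by rewrite EFinB !fineK// XFfin.
apply: (@outer_measure_bigcup_layers _ _ (@hausdorff R n k)).
- move=> i x [Xx xF]; split => // f /xF; apply: le_trans.
  by rewrite lef_pV2 ?posrE// ler_nat.
- move=> i; rewrite EFinB !fineK ?XFfin// leeBrDl ?XFfin//.
  apply: (@le_trans _ _ (hausdorff k ((X `&` F) `|` A i))).
    apply: (@hausdorff_sep _ _ _ i.+1%:R^-1); first by rewrite invr_gt0.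
    move=> x y [_ Fx] [_ /(_ _ Fx)].
    by rewrite -opprB euclid_normN.
  by apply: (le_outer_measure (@hausdorff R n k)) => x [[]|[]].
- move=> i C B CA BA.
  apply: (@hausdorff_sep _ _ _ (i.+1%:R^-1 - i.+2%:R^-1)).
    by rewrite subr_gt0 ltf_pV2 ?posrE// ltr_nat.
  move=> x y /CA[Xx xF] /BA[[Xy _] nAy].
  have [f Ff yf] : exists2 f, F f & (euclid_norm (y - f) < i.+2%:R^-1)%R.
    apply: contrapT => H; apply: nAy; split => // f Ff; rewrite leNgt.
    by apply/negP => yf; apply: H; exists f.
  have := ler_euclid_normD (x - y) (y - f); rewrite addrA subrK => xyf.
  by rewrite lerBlDr (le_trans (xF _ Ff))// (le_trans xyf)// lerD2l ltW.
Qed.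

Lemma borel_hausdorff_measurable (R : realType) n k (A : set (borelRV R n)) :
  measurable A -> measurable (A : set (hausdorffRV R n k)).
Proof.
suff: <<s @open 'rV[R]_n >> `<=` (measurable : set (set (hausdorffRV R n k))).
  exact.
apply: smallest_sub.
  split => [|B mB|B mB]; [exact: measurable0| |exact: bigcupT_measurable].
  by rewrite setTD; exact: measurableC.
move=> U oU; rewrite -(setCK U); apply: measurableC.
apply: closed_hausdorff_measurable; exact: open_closedC.
Qed.

End caratheodory_criterion.

(** * The Borel sigma-algebra of row vectors *)

Section borel_rV.
Variable R : realType.

Lemma open_borel n (U : set 'rV[R]_n) : open U -> measurable (U : set (borelRV R n)).
Proof. exact: sub_sigma_algebra. Qed.

Lemma closed_borel n (F : set 'rV[R]_n) : closed F -> measurable (F : set (borelRV R n)).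
Proof.
move=> cF; rewrite -(setCK F); apply: measurableC; apply: open_borel.
exact: closed_openC.
Qed.

Lemma continuous_borel n m (f : 'rV[R]_n -> 'rV[R]_m) : continuous f ->
  measurable_fun setT (f : borelRV R n -> borelRV R m).
Proof.
move=> cf; apply: (@measurability _ _ (borelRV R n) (borelRV R m) setT f (@open _) erefl) => _ [U oU <-].
rewrite setTI; apply: open_borel; exact: open_comp.
Qed.

Lemma continuous_borel_real n (f : 'rV[R]_n -> R) : continuous f ->
  measurable_fun setT (f : borelRV R n -> measurableTypeR R).
Proof.
move=> cf; apply: (measurability _ (RGenOInfty.measurableE R)) => _ [_ [a ->] <-].
by rewrite setTI; apply: open_borel; apply: open_comp.
Qed.

(** The product sigma-algebra contains the open sets of the product because rational
    boxes form a countable base. *)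
Lemma open_prod_borel a b (W : set ('rV[R]_a * 'rV[R]_b)) : open W ->
  measurable (W : set (borelRV R a * borelRV R b)).
Proof.
move=> oW.
pose box (q : 'rV[rat]_a * 'rV[rat]_b * nat) : set (borelRV R a * borelRV R b) :=
  (ball (map_mx ratr q.1.1 : 'rV[R]_a) q.2.+1%:R^-1 : set 'rV[R]_a) `*`
  (ball (map_mx ratr q.1.2 : 'rV[R]_b) q.2.+1%:R^-1 : set 'rV[R]_b).
have mbox q : measurable (box q).
  by apply: measurableX; apply: open_borel; apply: ball_open.
rewrite (_ : W = \bigcup_(q in [set q | box q `<=` W]) box q); last first.
  apply/seteqP; split => [[x y] Wxy|xy [q /= qW]]; last exact: qW.
  have /nbhs_ballP[e /= e0 eW] : nbhs (x, y) W by exact: open_nbhs_nbhs.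
  have [k ke] : exists k, k.+1%:R^-1 < e / 2.
    have e20 : 0 < e / 2 by rewrite divr_gt0.
    exists (Num.truncn (e / 2)^-1); rewrite invf_plt ?posrE// ?invr_gt0//.
    exact: truncnS_gt.
  have k0 : (0 : R) < k.+1%:R^-1 by rewrite invr_gt0.
  have [p px] := ratr_rV_near x k0; have [q qy] := ratr_rV_near y k0.
  exists ((p, q), k) => //= -[x' y'] /= [px' qy']; apply: eW.
  have ee : k.+1%:R^-1 + k.+1%:R^-1 <= e by rewrite (splitr e) lerD// ltW.
  by split => /=; apply: (le_ball ee); [apply: ball_triangle (ball_sym px) px'|
    apply: ball_triangle (ball_sym qy) qy'].
rewrite bigcup_mkcond; apply: countable_bigcupT_measurable => // q.
by case: ifPn.
Qed.

Lemma continuous_prod_borel a b c (f : 'rV[R]_a * 'rV[R]_b -> 'rV[R]_c) :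
  continuous f ->
  measurable_fun setT (f : borelRV R a * borelRV R b -> borelRV R c).
Proof.
move=> cf; apply: (@measurability _ _ (borelRV R a * borelRV R b)%type (borelRV R c) setT f (@open _) erefl) => _ [U oU <-].
rewrite setTI; apply: open_prod_borel; exact: open_comp.
Qed.

Lemma translation_continuous n (a : 'rV[R]_n) : continuous (fun x : 'rV[R]_n => x + a).
Proof. by move=> x; exact: (cvgD cvg_id (cvg_cst a)). Qed.

Lemma mulmx_rV_continuous n m (M : 'M[R]_(n, m)) : continuous (fun x : 'rV[R]_n => x *m M).
Proof.
have [C C0 MC] := euclid_norm_mulmx_bound M.
move=> x; suff H (e : R) : 0 < e -> \forall y \near x, ball (x *m M) e (y *m M).
  by apply/(@cvgrPdist_lt _ _ _ _ (nbhs_filter x)) => e /H; rewrite mx_norm_ball.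
move=> e0.
have n0 : 0 < n.+1%:R :> R by [].
have D0 : 0 < C * n.+1%:R by rewrite mulr_gt0.
have e'0 : 0 < e / (C * n.+1%:R) := divr_gt0 e0 D0.
near=> y.
have [_ xy] : ball x (e / (C * n.+1%:R)) y.
  by near: y; exact: nbhsx_ballx.
split=> // i j; rewrite ord1 /ball/=.
have := euclid_norm_le_coord ((x - y) *m M) j.
rewrite mulmxBl !mxE => /le_lt_trans; apply.
rewrite -mulmxBl; apply: le_lt_trans (MC _) _; rewrite -ltr_pdivlMl//.
apply: le_lt_trans (euclid_norm_le_sum _) _.
apply: (@le_lt_trans _ _ (\sum_(i < n) (e / (C * n.+1%:R)))).
  apply: ler_sum => k _; rewrite !mxE; apply: ltW; exact: xy.
rewrite sumr_const card_ord -[ltLHS]mulr_natr.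
have -> : e / (C * n.+1%:R) * n%:R = C^-1 * e * (n%:R / n.+1%:R).
  by rewrite invfM mulrA (mulrC e) -!mulrA (mulrC n.+1%:R^-1) -!mulrA.
by rewrite gtr_pMr ?mulr_gt0 ?invr_gt0// ltr_pdivrMr// mul1r ltr_nat.
Unshelve. all: by end_near. Qed.

Lemma row_mx_continuous a b : continuous (fun p : 'rV[R]_a * 'rV[R]_b => row_mx p.1 p.2).
Proof.
move=> [x y]; apply/(@cvgrPdist_lt _ _ _ _ (nbhs_filter (x, y))) => e e0; near=> p.
suff: ball (row_mx x y) e (row_mx p.1 p.2) by rewrite mx_norm_ball.
have [[_ xp] [_ yp]] : ball (x, y) e p by near: p; exact: nbhsx_ballx.
split=> // i j; rewrite !mxE.
by case: (fintype.split j) => k; [exact: xp|exact: yp].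
Unshelve. all: by end_near. Qed.

Definition box n (a : 'rV[R]_n) (l : R) : set 'rV[R]_n :=
  [set x | forall i, a ord0 i <= x ord0 i <= a ord0 i + l].

Lemma compact_box n (a : 'rV[R]_n) l : compact (box a l).
Proof.
have -> : box a l = [set x : 'rV[R]_n | forall i, `[a ord0 i, a ord0 i + l]%classic (x ord0 i)].
  by apply/funext => x; apply/propext; split => H i; have := H i; rewrite /= in_itv.
apply: (@rV_compact _ n (fun i => `[a ord0 i, a ord0 i + l]%classic)) => i.
exact: segment_compact.
Qed.

Lemma compact_borel n (K : set 'rV[R]_n) : compact K -> measurable (K : set (borelRV R n)).
Proof. by move=> cK; apply: closed_borel; apply: compact_closed cK; exact: norm_hausdorff. Qed.

Lemma unit_cube_box n : @unit_cube R n = box 0 1.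
Proof.
by apply/funext => x; apply/propext; split => H i; have := H i; rewrite mxE add0r.
Qed.

End borel_rV.

(** * Uniqueness of translation invariant measures *)

Section translation_invariance.
Variables (R : realType) (n : nat).
Local Open Scope ereal_scope.
Implicit Types mu nu : {measure set (borelRV R n) -> \bar R}.

Definition translation_invariant (mu : set (borelRV R n) -> \bar R) :=
  forall (a : 'rV[R]_n) (A : set (borelRV R n)), measurable A ->
    mu [set x : 'rV[R]_n | A (x + a)%R] = mu A.

Lemma measurable_translate (a : 'rV[R]_n) (A : set (borelRV R n)) : measurable A ->
  measurable ([set x : 'rV[R]_n | A (x + a)%R] : set (borelRV R n)).
Proof.
move=> mA; rewrite -[X in measurable X]setTI.
exact: (continuous_borel (@translation_continuous R n a)).
Qed.

Lemma measurable_neg (A : set (borelRV R n)) : measurable A ->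
  measurable ([set x : 'rV[R]_n | A (- x)%R] : set (borelRV R n)).
Proof.
move=> mA; rewrite -[X in measurable X]setTI.
apply: (@continuous_borel R n n -%R _ measurableT) => //.
by move=> x; exact: (cvgN cvg_id).
Qed.

Lemma measurable_cube : measurable (@unit_cube R n : set (borelRV R n)).
Proof.
by rewrite unit_cube_box; apply: compact_borel; exact: compact_box.
Qed.

(** The integer translates of the unit cube cover the space. *)
Lemma translation_invariant_sigma_finite mu : translation_invariant mu ->
  mu (@unit_cube R n) < +oo -> sigma_finite setT mu.
Proof.
move=> muT mucube.
pose v i : 'rV[R]_n := if unpickle i is Some z then map_mx intr (z : 'rV[int]_n) else 0%R.
exists (fun i => [set x : 'rV[R]_n | @unit_cube R n (x + v i)%R]).
  apply/seteqP; split => // x _.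
  pose z : 'rV[int]_n := \row_i (- Num.floor (x ord0 i))%R.
  exists (pickle z) => //= i; rewrite /v pickleK !mxE rmorphN/=.
  by rewrite subr_ge0 floor_le/= lerBlDr addrC -(intrD _ _ 1) ltW// floorD1_gt.
move=> i; split; first exact: measurable_translate measurable_cube.
by rewrite muT//; exact: measurable_cube.
Qed.

Section uniqueness.
Variables mu nu : {sigma_finite_measure set (borelRV R n) -> \bar R}.
Hypotheses (muT : translation_invariant mu) (nuT : translation_invariant nu).

Let product_measure_eq (S : set (borelRV R n * borelRV R n)) : measurable S ->
  (mu \x nu) S = (mu \x^ nu) S.
Proof.
by move=> mS; apply: product_measure_unique => // *; exact: product_measure2E.
Qed.

(** The measures of the set of pairs [(x, y)] with [x] in [A] and [x + y] in [B] under
    [mu x nu] can be computed in two ways: integrating over [y] first, translation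
    invariance of [nu] gives the left-hand side; shifting [x] by [y], which does not
    change [mu], turns it into the pairs with [x - y] in [A] and [x] in [B], hence the
    right-hand side. *)
Lemma translation_invariant_reflect A B : measurable A -> measurable B ->
  mu A * nu B = mu B * nu [set x : 'rV[R]_n | A (- x)%R].
Proof.
move=> mA mB.
pose S : set (borelRV R n * borelRV R n) :=
  [set p : 'rV[R]_n * 'rV[R]_n | A p.1 /\ B (p.1 + p.2)%R].
pose S' : set (borelRV R n * borelRV R n) :=
  [set p : 'rV[R]_n * 'rV[R]_n | A (p.1 - p.2)%R /\ B p.1].
have mfst : measurable_fun setT (fst : borelRV R n * borelRV R n -> borelRV R n).
  exact: measurable_fst.
have mS : measurable S.
  rewrite (_ : S = (fst @^-1` A) `&` ((fun p : 'rV[R]_n * 'rV[R]_n => p.1 + p.2)%R @^-1` B)) //.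
  apply: measurableI; first by rewrite -[X in measurable X]setTI; exact: mfst.
  rewrite -[X in measurable X]setTI.
  by apply: (@continuous_prod_borel R n n n _ _ measurableT) => //; exact: add_continuous.
have mS' : measurable S'.
  rewrite (_ : S' = ((fun p : 'rV[R]_n * 'rV[R]_n => p.1 - p.2)%R @^-1` A) `&` (fst @^-1` B)) //.
  apply: measurableI; last by rewrite -[X in measurable X]setTI; exact: mfst.
  rewrite -[X in measurable X]setTI.
  by apply: (@continuous_prod_borel R n n n _ _ measurableT) => //; exact: sub_continuous.
transitivity ((mu \x nu) S).
  rewrite /product_measure1 -[in LHS](setIT A) -integral_indic//.
  rewrite -ge0_integralZr//=; last first.
    by apply/measurable_EFinP; exact: measurable_indic.
  apply: eq_integral => x _; rewrite indicE.
  have -> : xsection S x = if x \in A then [set y : 'rV[R]_n | B (y + x)%R] else set0.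
    apply/seteqP; split => y; rewrite /xsection/= inE/=.
      by move=> [Ax Bxy]; rewrite mem_set//= addrC.
    by case: ifPn => // /set_mem Ax /=; rewrite addrC.
  by case: ifPn => _; rewrite ?mul1e ?mul0e ?measure0// nuT.
rewrite product_measure_eq//.
have -> : (mu \x^ nu) S = (mu \x^ nu) S'.
  apply: eq_integral => y _ /=.
  have mS'y : measurable (ysection S' y) by exact: measurable_ysection.
  rewrite -(muT y mS'y); congr (mu _).
  by apply/funext => x; apply/propext; rewrite /ysection/= !inE /S /S'/= addrK.
rewrite -product_measure_eq// /product_measure1 -[in RHS](setIT B) -integral_indic//.
rewrite -ge0_integralZr//=; last first.
  by apply/measurable_EFinP; exact: measurable_indic.
apply: eq_integral => x _; rewrite indicE.
have -> : xsection S' x = if x \in B then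
    [set y : 'rV[R]_n | [set z : 'rV[R]_n | A (- z)%R] (y - x)%R] else set0.
  apply/seteqP; split => y; rewrite /xsection/= inE/=.
    by move=> [Axy Bx]; rewrite mem_set//= opprB.
  by case: ifPn => // /set_mem Bx /=; rewrite opprB.
case: ifPn => _; rewrite ?mul1e ?mul0e ?measure0// nuT//.
exact: measurable_neg.
Qed.

End uniqueness.

Section normalized_uniqueness.
Variables mu nu : {measure set (borelRV R n) -> \bar R}.
Hypotheses (muT : translation_invariant mu) (nuT : translation_invariant nu).
Hypotheses (mucube : mu (@unit_cube R n) < +oo) (nucube : nu (@unit_cube R n) = 1).

Let nucube_lty : nu (@unit_cube R n) < +oo.
Proof. by rewrite nucube ltry. Qed.

Let smu : set (borelRV R n) -> \bar R := mu.
Let snu : set (borelRV R n) -> \bar R := nu.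

HB.instance Definition _ := Measure.on smu.
HB.instance Definition _ := Measure.on snu.
HB.instance Definition _ := Measure_isSigmaFinite.Build _ _ _ smu
  (translation_invariant_sigma_finite muT mucube).
HB.instance Definition _ := Measure_isSigmaFinite.Build _ _ _ snu
  (translation_invariant_sigma_finite nuT nucube_lty).

(** Taking the cube for [B] in [translation_invariant_reflect] compares [mu A] with the
    [nu]-measure of the reflected set; the case [mu = nu] removes the reflection. *)
Lemma translation_invariant_unique A : measurable A ->
  mu A = mu (@unit_cube R n) * nu A.
Proof.
move=> mA.
have nuN : nu A = nu [set x : 'rV[R]_n | A (- x)%R].
  have : nu A * nu (@unit_cube R n) =
      nu (@unit_cube R n) * nu [set x : 'rV[R]_n | A (- x)%R].
    exact: (@translation_invariant_reflect snu snu nuT nuT _ _ mA measurable_cube).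
  by rewrite nucube mule1 mul1e.
have : mu A * nu (@unit_cube R n) =
    mu (@unit_cube R n) * nu [set x : 'rV[R]_n | A (- x)%R].
  exact: (@translation_invariant_reflect smu snu muT nuT _ _ mA measurable_cube).
by rewrite nucube mule1 -nuN.
Qed.

End normalized_uniqueness.

End translation_invariance.

(** * Lebesgue measure on row vectors *)

Section pushforward_measure.
Context d d' (T : measurableType d) (T' : measurableType d') (R : realType).
Variables (mu : {measure set T -> \bar R}) (f : T -> T') (mf : measurable_fun setT f).

Definition pushforward_measure : {measure set T' -> \bar R} :=
  measure_function_pushforward__canonical__measure_function_Measure mu mf.

End pushforward_measure.

Lemma ge0_integral_measure_preserving d d' (T : measurableType d)
    (T' : measurableType d') (R : realType) (mu : {measure set T -> \bar R})
    (nu : {measure set T' -> \bar R}) (f : T -> T') (g : T' -> \bar R) :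
  measurable_fun setT f ->
  (forall A, measurable A -> mu (f @^-1` A) = nu A) ->
  measurable_fun setT g -> (forall y, 0 <= g y)%E ->
  (\int[mu]_x g (f x) = \int[nu]_y g y)%E.
Proof.
move=> mf munu mg g0.
have := @ge0_integral_pushforward _ _ _ _ R f mf mu setT g measurableT mg (fun y _ => g0 y).
rewrite preimage_setT => <-.
by apply: (@eq_measure_integral _ _ _ _ nu (pushforward_measure mu mf)) => A mA _; exact: munu.
Qed.

Section lebesgue_measure_rV.
Variable R : realType.
Local Open Scope ereal_scope.

Lemma lebesgue_measure_translate (s : R) (A : set (measurableTypeR R)) :
  measurable A -> lebesgue_measure [set t : R | A (t + s)%R] = lebesgue_measure A.
Proof.
move=> mA.
have mf : measurable_fun setT ((fun t : R => t + s)%R : measurableTypeR R -> measurableTypeR R).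
  exact: measurable_funD.
apply/esym/(@lebesgue_measure_unique R (pushforward_measure lebesgue_measure mf)) => //=.
move=> _ [[a b]] _ <-; rewrite /pushforward/=.
rewrite [X in _ = lebesgue_measure X](_ : _ = (`](a - s)%R, (b - s)%R]%classic : set R)); last first.
  by apply/seteqP; split => t /=; rewrite !in_itv/= ltrBlDr lerBrDr.
by rewrite !lebesgue_measure_itv/= !lte_fin ltrD2r -!EFinB opprB addrA subrK.
Qed.

(** A copy of [borel_lebesgue], which is defined by recursion on the dimension, that
    carries the structure of a sigma-finite measure for variable [n]. *)
Definition leb n : set (borelRV R n) -> \bar R := borel_lebesgue R n.

HB.instance Definition _ n := Measure.on (@leb n).

Lemma measurable_consRV_preimage n (A : set (borelRV R n.+1)) : measurable A ->
  measurable (@consRV R n @^-1` A).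
Proof. by move=> mA; rewrite -[X in measurable X]setTI; exact: measurable_consRV. Qed.

(** The recursion defining Lebesgue measure, read as Tonelli: integrate the lengths of
    the sections in the first coordinate. *)
Lemma lebS n (A : set (borelRV R n.+1)) :
  leb A = \int[@leb n]_x lebesgue_measure (ysection (@consRV R n @^-1` A) x).
Proof. by []. Qed.

Lemma leb_rect n (I : set (measurableTypeR R)) (B : set (borelRV R n))
    (A : set (borelRV R n.+1)) : measurable I -> measurable B ->
  (forall t x, A (consRV (t, x)) <-> I t /\ B x) ->
  leb A = lebesgue_measure I * leb B.
Proof.
move=> mI mB AE; rewrite -(product_measure2E lebesgue_measure (@leb n) mI mB).
change (leb A) with ((lebesgue_measure \x^ @leb n) (@consRV R n @^-1` A)).
congr (_ _); apply/seteqP; split => -[t x] /=; first by move/AE.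
by move=> tx; apply/AE.
Qed.

Lemma leb_box n (a : 'rV[R]_n) (l : R) : (0 <= l)%R -> leb (box a l) = (l ^+ n)%:E.
Proof.
move=> l0; elim: n a => [|n ih] a.
  by rewrite /leb/= /dirac indicE mem_set// => -[].
pose s : R := (lsubmx (a : 'rV[R]_(1 + n)) ord0 ord0).
pose b : 'rV[R]_n := rsubmx (a : 'rV[R]_(1 + n)).
rewrite (@leb_rect n `[s, (s + l)%R]%classic (box b l))//=.
- rewrite lebesgue_measure_itv/= lte_fin ltrDl ih exprS EFinM.
  by case: ltgtP l0 => // [l0|<-] _; [rewrite -EFinB addrAC subrr add0r|rewrite !mul0e].
- by apply: compact_borel; exact: compact_box.
- move=> t x; rewrite /consRV in_itv/=; split.
    move=> H; split.
      by have := H (lshift n ord0 : 'I_(1 + n)); rewrite (@row_mxEl _ 1 1 n) mxE /s mxE.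
    by move=> i; have := H (rshift 1 i : 'I_(1 + n)); rewrite (@row_mxEr _ 1 1 n) /b mxE.
  move=> [t01 x01] i; rewrite mxE -[i](splitK (i : 'I_(1 + n))).
  rewrite unsplitK; case: (fintype.split (i : 'I_(1 + n))) => j /=.
    by rewrite mxE (ord1 j); move: t01; rewrite /s mxE.
  by have := x01 j; rewrite /b mxE.
Qed.

Lemma leb_unit_cube n : leb (@unit_cube R n) = 1.
Proof. by rewrite unit_cube_box leb_box// expr1n. Qed.

Lemma leb_translation_invariant n : translation_invariant (@leb n).
Proof.
elim: n => [|n ih] a A mA.
  have -> // : [set x : 'rV[R]_0 | A (x + a)%R] = A.
  by apply/funext => x /=; congr (A _); apply/rowP => -[].
have mcA := measurable_consRV_preimage mA.
pose g y := lebesgue_measure (ysection (@consRV R n @^-1` A) y).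
have mg : measurable_fun setT g by exact: measurable_fun_ysection.
pose s : R := (lsubmx (a : 'rV[R]_(1 + n)) ord0 ord0).
pose b : 'rV[R]_n := rsubmx (a : 'rV[R]_(1 + n)).
transitivity (\int[@leb n]_x g (x + b)%R).
  rewrite lebS; apply: eq_integral => x _; rewrite /g.
  have mAx : measurable (ysection (@consRV R n @^-1` A) (x + b)%R).
    exact: measurable_ysection.
  rewrite -(lebesgue_measure_translate s mAx).
  congr (lebesgue_measure _); apply/funext => t; apply/propext.
  have E : (consRV (t, x) + a)%R = consRV (t + s, x + b)%R.
    rewrite /consRV/= -[a in LHS](hsubmxK (a : 'rV[R]_(1 + n))).
    rewrite (@add_row_mx _ 1 1 n) (_ : _ + lsubmx _ = const_mx (t + s))%R//.
    by apply/matrixP => i j; rewrite /s !mxE !ord1.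
  by rewrite /ysection/= !inE/= E.
rewrite lebS.
apply: (@ge0_integral_measure_preserving _ _ _ _ _ (@leb n) (@leb n)) => //.
- exact: continuous_borel (@translation_continuous R n b).
- by move=> B mB; exact: ih.
Qed.

Lemma leb_sigma_finite n : sigma_finite setT (@leb n).
Proof.
apply: translation_invariant_sigma_finite; first exact: leb_translation_invariant.
by change (leb (@unit_cube R n) < +oo); rewrite leb_unit_cube ltry.
Qed.

HB.instance Definition _ n := Measure_isSigmaFinite.Build _ _ _ (@leb n) (@leb_sigma_finite n).

Lemma leb_unique n (mu : {measure set (borelRV R n) -> \bar R}) :
  translation_invariant mu -> mu (@unit_cube R n) < +oo ->
  forall A, measurable A -> mu A = mu (@unit_cube R n) * leb A.
Proof.
move=> muT mucube A mA.
apply: (@translation_invariant_unique _ _ mu (@leb n)) => //.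
  exact: leb_translation_invariant.
exact: leb_unit_cube.
Qed.

Definition row_pair m k (p : borelRV R m * borelRV R k) : borelRV R (m + k) :=
  row_mx (p.1 : 'rV[R]_m) (p.2 : 'rV[R]_k).

Lemma measurable_row_pair m k : measurable_fun setT (@row_pair m k).
Proof. exact: continuous_prod_borel (@row_mx_continuous R m k). Qed.

Lemma measurable_row_pair_preimage m k (A : set (borelRV R (m + k))) :
  measurable A -> measurable (@row_pair m k @^-1` A).
Proof. by move=> mA; rewrite -[X in measurable X]setTI; exact: measurable_row_pair. Qed.

Lemma xsection_row_pair m k (A : set (borelRV R (m + k))) (y : 'rV[R]_m) :
  xsection (@row_pair m k @^-1` A) y = [set z : 'rV[R]_k | A (row_mx y z)].
Proof. by apply/funext => z; apply/propext; rewrite /xsection/= inE. Qed.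

Lemma measurable_section m k (A : set (borelRV R (m + k))) (y : 'rV[R]_m) :
  measurable A -> measurable ([set z : 'rV[R]_k | A (row_mx y z)] : set (borelRV R k)).
Proof.
move=> mA; rewrite -xsection_row_pair; apply: measurable_xsection.
exact: measurable_row_pair_preimage.
Qed.

Lemma measurable_leb_section m k (A : set (borelRV R (m + k))) : measurable A ->
  measurable_fun setT ((fun y => leb [set z : 'rV[R]_k | A (row_mx y z)]) : borelRV R m -> \bar R).
Proof.
move=> mA; under [X in measurable_fun _ X]eq_fun do rewrite -xsection_row_pair.
apply: (measurable_fun_xsection (@leb k)); exact: measurable_row_pair_preimage.
Qed.

(** Both sides are translation invariant in [A] and give the unit cube the mass [1]. *)
Lemma leb_prod m k (A : set (borelRV R (m + k))) : measurable A ->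
  leb A = \int[@leb m]_y leb [set z : 'rV[R]_k | A (row_mx y z)].
Proof.
move=> mA.
pose nu := pushforward_measure (@leb m \x @leb k) (@measurable_row_pair m k).
have nuE B : nu B = \int[@leb m]_y leb [set z : 'rV[R]_k | B (row_mx y z)].
  by apply: eq_integral => y _; rewrite -xsection_row_pair.
have nuT : translation_invariant nu.
  move=> a B mB; rewrite !nuE.
  pose g (y : 'rV[R]_m) := leb [set z : 'rV[R]_k | B (row_mx y z)].
  transitivity (\int[@leb m]_y g (y + lsubmx a)%R).
    apply: eq_integral => y _; rewrite /g.
    rewrite -(leb_translation_invariant (rsubmx a) (measurable_section _ mB)).
    congr (leb _); apply/funext => z; apply/propext => /=.
    by rewrite -[a in (row_mx _ _ + a)%R]hsubmxK add_row_mx.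
  apply: (@ge0_integral_measure_preserving _ _ _ _ _ (@leb m) (@leb m)) => //.
  - exact: continuous_borel (@translation_continuous R m (lsubmx a)).
  - by move=> C mC; exact: leb_translation_invariant.
  - exact: measurable_leb_section.
have nucube : nu (@unit_cube R (m + k)) = 1.
  transitivity (leb (@unit_cube R m) * leb (@unit_cube R k)); last first.
    by rewrite !leb_unit_cube mule1.
  rewrite -(product_measure1E (@leb m) (@leb k) (@measurable_cube R m) (@measurable_cube R k)).
  congr ((_ \x _) _); apply/seteqP; split => [[y z] /= yz|[y z] /= [yc zc] i].
    split => i; first by have := yz (lshift k i); rewrite row_mxEl.
    by have := yz (rshift m i); rewrite row_mxEr.
  by rewrite mxE; case: (fintype.split i) => j.
have nuoo : nu (@unit_cube R (m + k)) < +oo by rewrite nucube ltry.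
transitivity (nu A); last exact: nuE.
by have := leb_unique nuT nuoo mA; rewrite nucube mul1e => ->.
Qed.

End lebesgue_measure_rV.

(** * Hausdorff measure of full dimension *)

Section hausdorff_lebesgue.
Variable R : realType.
Local Open Scope ereal_scope.

(** Cover the cube by [N ^ k] grid cubes of side [1 / N]; each has diameter at most
    [k / N]. *)
Lemma hausdorff_unnormalized_cube_le k :
  hausdorff_unnormalized k (@unit_cube R k) <= (k%:R ^+ k)%:E.
Proof.
apply: ge_ereal_sup => _ [delta /= d0 <-].
have [N Nd] : exists N, (k%:R / N.+1%:R <= delta)%R.
  exists (Num.truncn (k%:R / delta)%R).
  by rewrite ler_pdivrMr// mulrC -ler_pdivrMr// ltW// truncnS_gt.
(* the N.+1 ^ k grid cubes of side 1 / N.+1 *)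
pose T := {ffun 'I_k -> 'I_N.+1}.
pose G (f : T) : set 'rV[R]_k :=
  box (\row_j ((f j)%:R / N.+1%:R))%R N.+1%:R^-1.
pose F i : set 'rV[R]_k := if insub i is Some j then G (enum_val (j : 'I_#|T|)) else set0.
have dG f : diameter (G f) <= (k%:R / N.+1%:R)%:E.
  apply: diameter_le => x y Gx Gy; apply: (le_trans (euclid_norm_le_sum _)).
  apply: (@le_trans _ _ (\sum_(i < k) (N.+1%:R^-1 : R))%R).
    apply: ler_sum => i _; have := Gx i; have := Gy i; rewrite !mxE.
    set c := (_ / _)%R; set e := (_^-1)%R.
    by move=> /andP[? ?] /andP[? ?]; rewrite ler_norml; apply/andP; split; lra.
  by rewrite sumr_const card_ord mulr_natl.
have c0 : (0 <= k%:R / N.+1%:R :> R)%R by rewrite divr_ge0.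
have cardT : #|T| = (N.+1 ^ k)%N by rewrite card_ffun !card_ord.
apply: (@le_trans _ _ (\sum_(i <oo) hausdorff_weight k (F i))).
  apply: ereal_inf_lbound; exists F => //; split; last first.
    move=> i; rewrite /F; case: insubP => [j _ _|_].
      by apply: (le_trans (dG _)); rewrite lee_fin.
    by rewrite /diameter setX0 image_set0 ereal_sup0 leNye.
  move=> x xc; pose f : T := [ffun j => inord (minn N (Num.truncn (x ord0 j * N.+1%:R)%R))].
  exists (enum_rank f) => //; rewrite /F valK /= enum_rankK => j.
  rewrite !mxE ffunE inordK ?ltnS ?geq_minl//.
  have /andP[x0 x1] := xc j.
  have xN0 : (0 <= x ord0 j * N.+1%:R)%R by rewrite mulr_ge0.
  rewrite ler_pdivrMr// -[X in (_ <= _ + X)%R]mul1r -mulrDl ler_pdivlMr//.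
  rewrite -(natrD _ _ 1) addn1; apply/andP; split.
    apply: le_trans (_ : (Num.truncn (x ord0 j * N.+1%:R))%:R <= _)%R; last by rewrite truncn_le.
    by rewrite ler_nat geq_minr.
  have [NT|TN] := leqP N (Num.truncn (x ord0 j * N.+1%:R)%R).
    by rewrite ler_piMl.
  by rewrite ltW// truncnS_gt.
have wF i : hausdorff_weight k (F i) <=
    if (i < #|T|)%N then ((k%:R / N.+1%:R) ^+ k)%:E else 0.
  rewrite /F; case: insubP => [j -> _|/negbTE ->].
    by apply: hausdorff_weight_le => //; exact: dG.
  by rewrite hausdorff_weight0.
have sumF n : \sum_(0 <= i < n) hausdorff_weight k (F i) <=
    ((minn n #|T|)%:R * (k%:R / N.+1%:R) ^+ k)%:E.
  elim: n => [|n ih]; first by rewrite big_nil min0n mul0r.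
  rewrite big_nat_recr//=; apply: (le_trans (leeD ih (wF n))).
  case: ltnP => nT; last by rewrite adde0 (minn_idPr (leqW nT)).
  rewrite -EFinD lee_fin -[X in (_ + X)%R]mul1r -mulrDl ler_wpM2r ?exprn_ge0//.
  by rewrite -(natrD _ _ 1) addn1 ler_nat (minn_idPl nT).
apply: lime_le; first by apply: is_cvg_nneseries => i _ _; exact: hausdorff_weight_ge0.
apply: nearW => n; apply: (le_trans (sumF n)); rewrite lee_fin.
apply: (@le_trans _ _ (#|T|%:R * (k%:R / N.+1%:R) ^+ k)%R).
  by rewrite ler_wpM2r ?exprn_ge0// ler_nat geq_minr.
by rewrite cardT expr_div_n natrX mulrC divfK// expf_neq0.
Qed.

(** A set of diameter [D] lies in a cube of side [2 D], so a cover of the unit cube of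
    small total weight would cover it by boxes of small total volume. *)
Lemma leb_cube_le_hausdorff_pre k :
  1 <= (2 ^+ k)%:E * hausdorff_pre k 1 (@unit_cube R k).
Proof.
have p2 : (0 < 2 ^+ k :> R)%R by rewrite exprn_gt0.
rewrite -lee_pdivrMl// mule1; apply: le_ereal_inf_tmp => _ [F [cF Fd] <-].
rewrite -[X in X <= _]mule1 lee_pdivrMl//.
(* a set of diameter D lies in a box of side 2 D around any of its points *)
pose D i : R := fine (diameter (F i)).
pose B i : set (borelRV R k) :=
  if pselect (F i !=set0) is left e then box (projT1 (cid e) - const_mx (D i)) (2 * D i)
  else set0.
have DE i : F i !=set0 -> diameter (F i) = (D i)%:E.
  move=> F0; rewrite fineK// ge0_fin_numE ?diameter_ge0//.
  by rewrite (le_lt_trans (Fd i))// ltry.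
have D0 i : F i !=set0 -> (0 <= D i)%R by move=> F0; rewrite fine_ge0 ?diameter_ge0.
have mB i : measurable (B i).
  by rewrite /B; case: pselect => // e; apply: compact_borel; exact: compact_box.
have FB i : F i `<=` B i.
  move=> x Fx; rewrite /B; case: pselect => [e|[]]; last by exists x.
  case: cid => x0 /= Fx0 j; rewrite !mxE.
  have := diameter_ubound Fx Fx0; rewrite DE// lee_fin => xD.
  have := le_trans (euclid_norm_le_coord (x - x0) j) xD; rewrite !mxE ler_norml.
  by move=> /andP[? ?]; apply/andP; split; lra.
have wB i : leb (B i) <= (2 ^+ k)%:E * hausdorff_weight k (F i).
  rewrite /B; case: pselect => [e|nF].
    rewrite leb_box ?mulr_ge0 ?D0// hausdorff_weightE// DE// -EFin_expe -EFinM.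
    by rewrite -exprMn.
  by rewrite measure0 mule_ge0 ?lee_fin ?hausdorff_weight_ge0// ltW.
rewrite -nneseriesZl; last by move=> i _; exact: hausdorff_weight_ge0.
rewrite -(leb_unit_cube R k).
apply: (@le_trans _ _ (\sum_(i <oo) leb (B i))).
  apply: measure_sigma_subadditive => //; first exact: measurable_cube.
  by apply: subset_trans cF _; apply: subset_bigcup => i _; exact: FB.
by apply: lee_nneseries => i *; [exact: measure_ge0|exact: wB].
Qed.

(** The normalising factor is a true inverse because the unnormalised measure of the
    unit cube is neither zero nor infinite. *)
Lemma hausdorff_unit_cube k : hausdorff k (@unit_cube R k) = 1.
Proof.
rewrite /hausdorff /hausdorff_factor; set U := hausdorff_unnormalized _ _.
have Uge0 : 0 <= U by exact: hausdorff_unnormalized_ge0.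
have Ufin : U \is a fin_num.
  by rewrite ge0_fin_numE// (le_lt_trans (hausdorff_unnormalized_cube_le k))// ltry.
have U0 : fine U != 0%R.
  apply/eqP => U0; have := leb_cube_le_hausdorff_pre k.
  have : hausdorff_pre k 1 (@unit_cube R k) <= U by exact: hausdorff_pre_le.
  rewrite -(fineK Ufin) U0 => pre0.
  have -> : hausdorff_pre k 1 (@unit_cube R k) = 0.
    by apply/eqP; rewrite eq_le pre0 hausdorff_pre_ge0.
  by rewrite mule0 lee_fin ler10.
by rewrite -[X in _ * X](fineK Ufin) -EFinM mulVf.
Qed.

Lemma measurable_id_hausdorff_borel n k :
  measurable_fun setT (id : hausdorffRV R n k -> borelRV R n).
Proof. by move=> _ A mA; rewrite setTI; exact: borel_hausdorff_measurable. Qed.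

(** Hausdorff measure restricted to the Borel sets, where it can be compared with
    other Borel measures. *)
Definition hausdorff_borel n k : {measure set (borelRV R n) -> \bar R} :=
  pushforward_measure (@hausdorff_measure R n k) (@measurable_id_hausdorff_borel n k).

Lemma hausdorff_leb k (A : set (borelRV R k)) : measurable A -> hausdorff k A = leb A.
Proof.
move=> mA.
have HT : translation_invariant (hausdorff_borel k k).
  move=> a B mB; change (hausdorff k [set x : 'rV[R]_k | B (x + a)%R] = hausdorff k B).
  rewrite [X in hausdorff k X = _](_ : _ = (fun x => x - a)%R @` B).
    by apply: hausdorff_isometry => x y _ _; rewrite opprB addrA subrK.
  apply/seteqP; split => [x Bxa|_ [x Bx <-]/=]; last by rewrite subrK.
  by exists (x + a)%R => //; rewrite addrK.
have Hcube : hausdorff_borel k k (@unit_cube R k) = 1 by exact: hausdorff_unit_cube.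
have Hoo : hausdorff_borel k k (@unit_cube R k) < +oo by rewrite Hcube ltry.
by have := leb_unique HT Hoo mA; rewrite Hcube mul1e.
Qed.

End hausdorff_lebesgue.

(** * The linear change of variables *)

Section linear_change_of_variables.
Variable R : realType.

(** The factor by which [x |-> x M^-1] multiplies volumes, measured on the unit cube.
    It is shown to be multiplicative, then computed by Gaussian elimination. *)
Definition linear_scaling n (M : 'M[R]_n) : R :=
  fine (leb [set x : 'rV[R]_n | @unit_cube R n (x *m M)]).

Lemma measurable_mulmx_preimage n m (M : 'M[R]_(n, m)) (A : set (borelRV R m)) :
  measurable A -> measurable ([set x : 'rV[R]_n | A (x *m M)] : set (borelRV R n)).
Proof.
move=> mA; rewrite -[X in measurable X]setTI.
exact: (continuous_borel (@mulmx_rV_continuous R n m M)).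
Qed.

Lemma linear_scalingE n (M : 'M[R]_n) (A : set (borelRV R n)) :
  M \in unitmx -> measurable A ->
  leb [set x : 'rV[R]_n | A (x *m M)] = ((linear_scaling M)%:E * leb A)%E.
Proof.
move=> uM mA.
pose mu := pushforward_measure (@leb R n) (continuous_borel (@mulmx_rV_continuous R n n M)).
have muT : translation_invariant mu.
  move=> a B mB.
  transitivity (leb [set x : 'rV[R]_n | B (x *m M)]); last by [].
  rewrite -[RHS](leb_translation_invariant (a *m invmx M)); last first.
    exact: measurable_mulmx_preimage.
  congr (leb _); apply/funext => x /=.
  by rewrite mulmxDl mulmxKV.
have muoo : (mu (@unit_cube R n) < +oo)%E.
  have [C C0 HC] := euclid_norm_mulmx_bound (invmx M).
  pose r := C * n%:R.
  have r0 : 0 <= r by rewrite mulr_ge0// ltW.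
  apply: (@le_lt_trans _ _ (leb (box (const_mx (- r) : 'rV[R]_n) (2 * r)))); last first.
    by rewrite leb_box ?ltry// mulr_ge0.
  apply: (le_measure (@leb R n)); rewrite ?inE.
  - apply: measurable_mulmx_preimage; exact: measurable_cube.
  - by apply: compact_borel; exact: compact_box.
  - move=> x xM i; rewrite mxE.
    have : `|x ord0 i| <= r.
      apply: (le_trans (euclid_norm_le_coord x i)).
      rewrite -[x](mulmxK uM); apply: (le_trans (HC _)).
      rewrite ler_wpM2l ?(ltW C0)// (le_trans (euclid_norm_le_sum _))//.
      rewrite -[n in n%:R]card_ord -sum1_card natr_sum ler_sum// => j _.
      by have /andP[? ?] := xM j; rewrite ger0_norm.
    by rewrite ler_norml => /andP[? ?]; apply/andP; split; lra.
have mufin : mu (@unit_cube R n) \is a fin_num by rewrite ge0_fin_numE.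
rewrite /linear_scaling fineK//.
exact: (leb_unique muT muoo mA).
Qed.

Lemma linear_scalingM n (M N : 'M[R]_n) : M \in unitmx -> N \in unitmx ->
  linear_scaling (M *m N) = linear_scaling M * linear_scaling N.
Proof.
move=> uM uN; apply/EFin_inj; rewrite -[LHS]mule1 -(leb_unit_cube R n).
rewrite -linear_scalingE ?unitmx_mul ?uM//; last exact: measurable_cube.
have -> : [set x : 'rV[R]_n | @unit_cube R n (x *m (M *m N))] =
    [set x : 'rV[R]_n | [set y : 'rV[R]_n | @unit_cube R n (y *m N)] (x *m M)].
  by apply/funext => x /=; rewrite mulmxA.
rewrite linear_scalingE//; last by apply: measurable_mulmx_preimage; exact: measurable_cube.
rewrite linear_scalingE//; last exact: measurable_cube.
by rewrite leb_unit_cube mule1 EFinM.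
Qed.

Lemma linear_scaling1 n : linear_scaling (1%:M : 'M[R]_n) = 1.
Proof.
rewrite /linear_scaling (_ : [set x | _] = @unit_cube R n) ?leb_unit_cube//.
by apply/funext => x /=; rewrite mulmx1.
Qed.

Lemma linear_scaling_ge0 n (M : 'M[R]_n) : 0 <= linear_scaling M.
Proof. by rewrite /linear_scaling fine_ge0. Qed.

Lemma linear_scaling_neq0 n (M : 'M[R]_n) : M \in unitmx -> linear_scaling M != 0.
Proof.
move=> uM; apply/eqP => M0.
have uVM : invmx M \in unitmx by rewrite unitmx_inv.
have := linear_scalingM uM uVM.
rewrite mulmxV// linear_scaling1 M0 mul0r => /eqP.
by rewrite oner_eq0.
Qed.

(** A transposition is an involution, and scaling factors are nonnegative. *)
Lemma linear_scaling_tperm n (i j : 'I_n) : linear_scaling (tperm_mx i j : 'M[R]_n) = 1.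
Proof.
have uP := unitmx_perm R (tperm i j).
have := linear_scalingM uP uP.
rewrite -perm_mxM tperm2 perm_mx1 linear_scaling1 => /esym/eqP.
rewrite -expr2 sqrp_eq1 ?linear_scaling_ge0// => /eqP.
exact.
Qed.

Lemma linear_scaling_diag n (a : R) (S : 'M[R]_n) : a != 0 ->
  linear_scaling (block_mx (a%:M : 'M[R]_1) 0 0 S : 'M[R]_(1 + n)) =
  `|a|^-1 * linear_scaling S.
Proof.
move=> a0; rewrite /linear_scaling.
pose I : set R := [set t | 0 <= t * a <= 1].
have IE : I = if 0 < a then [set` `[0, a^-1]] else [set` `[a^-1, 0]].
  apply/seteqP; split => t; rewrite /I/=; case: ifPn => a_gt0 /=; rewrite in_itv/=.
  - by rewrite -ler_pdivrMr// mul0r -ler_pdivlMr// mul1r.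
  - have a_lt0 : a < 0 by rewrite lt_neqAle a0 leNgt.
    by rewrite -ler_ndivlMr// mul0r -ler_ndivrMr// mul1r andbC.
  - by rewrite -ler_pdivrMr// mul0r -ler_pdivlMr// mul1r.
  - have a_lt0 : a < 0 by rewrite lt_neqAle a0 leNgt.
    by rewrite -ler_ndivlMr// mul0r -ler_ndivrMr// mul1r andbC.
have mI : measurable (I : set (measurableTypeR R)).
  by rewrite IE; case: ifP => _; exact: measurable_itv.
have lI : lebesgue_measure (I : set (measurableTypeR R)) = (`|a|^-1)%:E.
  rewrite IE; case: ifPn => a_gt0; rewrite lebesgue_measure_itv/= lte_fin.
    by rewrite invr_gt0 a_gt0 oppr0 adde0 gtr0_norm.
  have a_lt0 : a < 0 by rewrite lt_neqAle a0 leNgt.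
  by rewrite invr_lt0 a_lt0 add0e ltr0_norm// invrN.
rewrite (@leb_rect R n I [set x : 'rV[R]_n | @unit_cube R n (x *m S)])//=.
- rewrite lI; have : 0 < `|a|^-1 by rewrite invr_gt0 normr_gt0.
  set r := (_^-1 : R) => r0; case: (leb _) => [s| |] //=.
    by rewrite gt0_muley// mulr0.
  by rewrite gt0_muleNy// mulr0.
- by apply: measurable_mulmx_preimage; exact: measurable_cube.
- move=> t x; rewrite /consRV/=.
  rewrite (@mul_row_block _ 1 1 n 1 n) !mulmx0 addr0 add0r mul_mx_scalar.
  split.
    move=> H; split.
      have := H (lshift n ord0 : 'I_(1 + n)); rewrite (@row_mxEl _ 1 1 n) !mxE.
      by rewrite /I/= mulrC.
    by move=> i; have := H (rshift 1 i : 'I_(1 + n)); rewrite (@row_mxEr _ 1 1 n).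
  move=> [t01 x01] i; rewrite -[i](splitK (i : 'I_(1 + n))).
  case: (fintype.split (i : 'I_(1 + n))) => j /=.
    by rewrite (@row_mxEl _ 1 1 n) !mxE mulrC.
  by rewrite (@row_mxEr _ 1 1 n).
Qed.

(** [D T = T T D] says that [T] is conjugate to its own square, so its scaling factor
    equals its square.  This applies to transvections without computing the volume of
    a sheared cube. *)
Lemma linear_scaling_conj_square n (D T : 'M[R]_n) :
  D \in unitmx -> T \in unitmx -> D *m T = T *m T *m D -> linear_scaling T = 1.
Proof.
move=> uD uT DT; have uTT : T *m T \in unitmx by rewrite unitmx_mul uT.
have := congr1 (@linear_scaling n) DT.
rewrite !linear_scalingM// -mulrA (mulrC (linear_scaling D)).
move=> /(mulfI (linear_scaling_neq0 uT)).
rewrite -[LHS]mul1r => /(mulIf (linear_scaling_neq0 uD)).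
by [].
Qed.

Lemma linear_scaling_upper n (c : 'rV[R]_n) :
  linear_scaling (block_mx (1%:M : 'M[R]_1) c 0 1%:M : 'M[R]_(1 + n)) = 1.
Proof.
apply: (@linear_scaling_conj_square _ (block_mx (2%:M : 'M[R]_1) 0 0 1%:M)).
- by rewrite unitmxE det_ublock !det_scalar expr1 expr1n mulr1 unitfE.
- by rewrite unitmxE det_ublock !det_scalar !expr1n mulr1 unitr1.
- rewrite !mulmx_block !(mul0mx, mulmx0, mul1mx, mulmx1, addr0, add0r).
  by rewrite mul_scalar_mx scaler_nat mulr2n.
Qed.

Lemma linear_scaling_lower n (c : 'cV[R]_n) :
  linear_scaling (block_mx (1%:M : 'M[R]_1) 0 c 1%:M : 'M[R]_(1 + n)) = 1.
Proof.
apply: (@linear_scaling_conj_square _ (block_mx ((2^-1)%:M : 'M[R]_1) 0 0 1%:M)).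
- by rewrite unitmxE det_ublock !det_scalar expr1 expr1n mulr1 unitfE invr_eq0.
- by rewrite unitmxE det_lblock !det_scalar !expr1n mulr1 unitr1.
- rewrite !mulmx_block !(mul0mx, mulmx0, mul1mx, mulmx1, addr0, add0r).
  rewrite mul_mx_scalar scalerDr -scalerDl (_ : 2^-1 + 2^-1 = 1 :> R) ?scale1r//.
  by field.
Qed.

(** Gaussian elimination of the first column: after a row exchange, [M] is the product
    of a lower transvection, a block diagonal matrix and an upper transvection. *)
Lemma linear_scaling_det n (M : 'M[R]_n) : M \in unitmx ->
  linear_scaling M = `|\det M|^-1.
Proof.
elim: n M => [|n ih] M uM.
  by rewrite det_mx00 normr1 invr1 -(linear_scaling1 0); congr linear_scaling;
    apply/matrixP => -[].
have [i Mi0] : exists i, M i ord0 != 0.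
  apply: contrapT => Mi0; move: uM; rewrite unitmxE unitfE => /eqP; apply.
  rewrite (expand_det_col _ ord0) big1// => i _.
  by have [->|Mi] := eqVneq (M i ord0) 0; [rewrite mul0r|case: Mi0; exists i].
pose M' : 'M[R]_(1 + n) := xrow ord0 i M.
have MM' : M = tperm_mx ord0 i *m M'.
  by rewrite /M' xrowE mulmxA -perm_mxM tperm2 perm_mx1 mul1mx.
have detM' : `|\det M'| = `|\det M|.
  by rewrite /M' xrowE det_mulmx det_perm normrM normr_sign mul1r.
have uM' : M' \in unitmx by rewrite unitmxE unitfE -normr_eq0 detM' normr_eq0 -unitfE.
rewrite -detM' {1}MM' linear_scalingM ?unitmx_perm// linear_scaling_tperm mul1r.
pose a : R := M' ord0 ord0.
have a0 : a != 0 by rewrite /a /M' mxE tpermL.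
pose r := ursubmx M'; pose c := dlsubmx M'; pose S := drsubmx M'.
have aE : ulsubmx M' = a%:M.
  have l0 : lshift n (ord0 : 'I_1) = ord0 :> 'I_n.+1 by apply/val_inj.
  by apply/matrixP => j k; rewrite /a !mxE (ord1 j) (ord1 k) l0 eqxx mulr1n.
pose S' := S - a^-1 *: (c *m r).
have fact : M' = block_mx (1%:M : 'M[R]_1) 0 (a^-1 *: c) 1%:M *m
    block_mx (a%:M : 'M[R]_1) 0 0 S' *m block_mx (1%:M : 'M[R]_1) (a^-1 *: r) 0 1%:M.
  rewrite !mulmx_block !(mul0mx, mulmx0, mul1mx, mulmx1, addr0, add0r).
  rewrite -[M' in LHS]submxK aE -/r -/c -/S; congr block_mx.
  - by rewrite mul_scalar_mx scalerA divff// scale1r.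
  - by rewrite mul_mx_scalar scalerA divff// scale1r.
  - rewrite mul_mx_scalar scalerA divff// scale1r -scalemxAr /S'.
    by rewrite addrC subrK.
have detfact : \det M' = a * \det S'.
  by rewrite fact !det_mulmx det_lblock !det_ublock !det_scalar !expr1n expr1 !mul1r !mulr1.
have uS' : S' \in unitmx.
  by move: uM'; rewrite !unitmxE !unitfE detfact mulf_eq0 negb_or => /andP[].
have u1 : block_mx (1%:M : 'M[R]_1) 0 (a^-1 *: c) 1%:M \in unitmx.
  by rewrite unitmxE det_lblock !det_scalar !expr1n mulr1 unitr1.
have u3 : block_mx (1%:M : 'M[R]_1) (a^-1 *: r) 0 1%:M \in unitmx.
  by rewrite unitmxE det_ublock !det_scalar !expr1n mulr1 unitr1.
have u2 : block_mx (a%:M : 'M[R]_1) 0 0 S' \in unitmx.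
  by rewrite unitmxE det_ublock !det_scalar expr1 unitfE mulf_neq0// -unitfE -unitmxE.
rewrite [in LHS]fact !linear_scalingM ?unitmx_mul ?u1 ?u2//.
rewrite linear_scaling_lower linear_scaling_upper linear_scaling_diag// ih//.
by rewrite mul1r mulr1 detfact normrM invfM.
Qed.

Lemma leb_mulmx_preimage n (M : 'M[R]_n) (A : set (borelRV R n)) :
  M \in unitmx -> measurable A ->
  leb [set x : 'rV[R]_n | A (x *m M)] = ((`|\det M|^-1)%:E * leb A)%E.
Proof. by move=> uM mA; rewrite linear_scalingE// linear_scaling_det. Qed.

End linear_change_of_variables.

(** * Orthonormal completion and strict differentiability *)

Section orthonormal_completion.
Variable R : realType.

(** One column at a time: a normalised vector in the left kernel of the columns found
    so far. *)
Lemma orthonormal_completion d m k (A : 'M[R]_(d, m)) : (m + k <= d)%N ->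
  exists L : 'M[R]_(d, k), L^T *m L = 1%:M /\ A^T *m L = 0.
Proof.
elim: k => [|k ih] mkd.
  exists 0; split; last by rewrite mulmx0.
  by apply/matrixP => -[].
have [L [LL AL]] : exists L : 'M[R]_(d, k), L^T *m L = 1%:M /\ A^T *m L = 0.
  by apply: ih; rewrite (leq_trans _ mkd)// addnS.
pose B := row_mx A L.
have : kermx B != 0.
  rewrite -mxrank_eq0 mxrank_ker subn_eq0 -ltnNge.
  by rewrite (leq_ltn_trans (rank_leq_col _))// -addnS.
case/rowV0Pn => v /sub_kermxP vB v0.
have ev0 : euclid_norm v != 0.
  by apply: contra v0 => /eqP/euclid_norm_eq0 ->.
pose w := (euclid_norm v)^-1 *: v.
have wB : w *m B = 0 by rewrite -scalemxAl vB scaler0.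
have ww : w *m w^T = 1%:M.
  apply/matrixP => i j; rewrite !ord1 [RHS]mxE eqxx -sqr_euclid_norm_mx.
  by rewrite euclid_normZ ger0_norm ?invr_ge0 ?euclid_norm_ge0// mulVf// expr1n.
move: wB; rewrite mul_mx_row -[0]row_mx0 => /eq_row_mx[wA wL].
exists (row_mx w^T L : 'M[R]_(d, 1 + k)); split.
  rewrite (@tr_row_mx _ d 1 k) (@mul_col_row _ 1 k d 1 k) trmxK ww wL LL -[L^T *m w^T]trmxK trmx_mul !trmxK wL trmx0.
  by rewrite -scalar_mx_block.
by rewrite (@mul_mx_row _ m d 1 k) AL -[A^T *m w^T]trmxK trmx_mul !trmxK wA trmx0 (@row_mx0 _ m 1 k).
Qed.

(** The Gram matrix of [(J L)] is block diagonal with blocks [J^T J] and [1]. *)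
Lemma normr_det_row_mx m k (J : 'M[R]_(m + k, m)) (L : 'M[R]_(m + k, k)) :
  L^T *m L = 1%:M -> J^T *m L = 0 ->
  `|\det (row_mx J L)| = Num.sqrt (\det (J^T *m J)).
Proof.
move=> LL JL; rewrite -sqrtr_sqr expr2 -{1}det_tr -det_mulmx tr_row_mx mul_col_row.
by rewrite JL LL det_lblock det1 mulr1.
Qed.

End orthonormal_completion.

Section mean_value.
Variable R : realType.

(** The mean value theorem on the segment from [y] to [x]; the point [t] depends on the
    coordinate [i], which is why the estimate is stated coordinatewise. *)
Lemma coord_mean_value d m (h : 'rV[R]_d -> 'rV[R]_m) (J : 'M[R]_(d, m)) x y i :
  (forall z, differentiable h z) ->
  exists2 t, 0 <= t <= 1 &
    (h x - h y - (x - y) *m J) ord0 i =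
    ((x - y) *m (jacobian h (y + t *: (x - y)) - J)) ord0 i.
Proof.
move=> dh; pose v := x - y; pose path (t : R) := y + t *: v.
pose g (t : R) : R := h (path t) ord0 i.
pose dg (t : R) : R := (v *m jacobian h (path t)) ord0 i.
have dpath t : is_diff t path (fun s : R => s *: v).
  have -> : (fun s : R => s *: v) = 0 + *:%R^~ v by apply/funext => s; rewrite fctE add0r.
  exact: is_diffD.
have dhpath t : differentiable (h \o path) t.
  by apply: differentiable_comp; [exact: ex_diff|exact: dh].
have Hg (t : R) : is_derive t (1 : R) g (dg t).
  have dt : derivable (h \o path : R -> 'rV[R]_m) t (1 : R) by exact: diff_derivable.
  apply: DeriveDef; first exact: ((derivable_mxP (h \o path) t 1).1 dt ord0 i).
  have := congr1 (fun M : 'rV[R]_m => M ord0 i) (derive_mx dt); rewrite mxE => <-.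
  rewrite deriveE// diff_comp//= diff_val scale1r -deriveE// deriveEjacobian//.
have cg : {within `[0, 1], continuous g}.
  apply: continuous_subspaceT => t; apply: differentiable_continuous.
  apply/derivable1_diffP; exact: ex_derive.
have [t] := MVT (@ltr01 R) (fun t _ => Hg t) cg.
rewrite in_itv/= => /andP[t0 t1]; rewrite subr0 mulr1 => gE.
exists t; first by rewrite !ltW.
rewrite -/v -/(path t) mulmxBr [RHS]mxE [X in _ = _ + X]mxE [LHS]mxE [X in _ + X = _]mxE.
congr (_ - _); rewrite -/(dg t) -gE /g /path scale0r scale1r addr0.
by rewrite /v (addrC y) subrK !mxE.
Qed.

Lemma jacobian_coord_continuous d m (h : 'rV[R]_d -> 'rV[R]_m) i j :
  continuously_differentiable h -> continuous (fun z => jacobian h z i j : R).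
Proof.
move=> [_ cJ].
have -> : (fun z => jacobian h z i j : R) = (fun M : 'M[R]_(m, d) => M j i : R) \o Jmx h.
  by apply/funext => z; rewrite /Jmx/= [RHS]mxE.
by move=> z; apply: continuous_comp; [exact: cJ|exact: coord_continuous].
Qed.

(** Unlike differentiability at [x0], this controls [h x - h y] for all [x] and [y] near
    [x0], which is what makes the chart below nearly isometric between any two points. *)
Lemma C1_strict_differentiability d m (h : 'rV[R]_d -> 'rV[R]_m) x0 (eps : R) :
  continuously_differentiable h -> 0 < eps ->
  \forall r \near 0^'+, forall x y, ball x0 r x -> ball x0 r y ->
    euclid_norm (h x - h y - (x - y) *m jacobian h x0) <= eps * euclid_norm (x - y).
Proof.
move=> hC1 eps0; have dh := hC1.1; pose N : R := (m * d).+1%:R.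
have N0 : 0 < N by rewrite ltr0n.
have eN0 : 0 < eps / N by rewrite divr_gt0.
have /nbhs_ballP[r /= r0 rJ] : \forall z \near x0, forall i j,
    `|jacobian h x0 i j - jacobian h z i j| < eps / N.
  apply: (@filter_forall _ _ _ _ (nbhs_filter x0)) => i.
  apply: (@filter_forall _ _ _ _ (nbhs_filter x0)) => j.
  have cj : (fun z => jacobian h z i j : R) @ x0 --> (jacobian h x0 i j : R).
    exact: jacobian_coord_continuous.
  by move/cvgrPdist_lt : cj; exact.
near=> s; move=> x y xs ys.
have sr : s <= r by near: s; exact: nbhs_right_le.
apply: (le_trans (euclid_norm_le_sum _)).
apply: (@le_trans _ _ (\sum_(i < m) \sum_(j < d) (eps / N * euclid_norm (x - y)))).
  apply: ler_sum => i _.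
  have [t /andP[t0 t1] ->] := coord_mean_value (jacobian h x0) x y i dh.
  set z := y + _; have zs : ball x0 s z.
    move: xs ys => [s0 xs] [_ ys]; split => // a b; rewrite ord1 /ball/= /z !mxE.
    have := xs ord0 b; have := ys ord0 b; rewrite /ball/= !ltr_norml.
    have t1' : 0 <= 1 - t by rewrite subr_ge0.
    have [xy|/ltW xy] := leP (x ord0 b) (y ord0 b);
      rewrite -subr_ge0 in xy; have := mulr_ge0 t0 xy; have := mulr_ge0 t1' xy;
      by move=> ? ? /andP[? ?] /andP[? ?]; apply/andP; split; lra.
  rewrite mxE (le_trans (ler_norm_sum _ _ _))//; apply: ler_sum => j _.
  rewrite normrM mulrC ler_pM// ?euclid_norm_le_coord//.
  have /rJ : ball x0 r z by exact: le_ball zs.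
  move=> /(_ j i) /ltW zJ.
  have -> : (jacobian h z - jacobian h x0) j i = jacobian h z j i - jacobian h x0 j i.
    by rewrite mxE; congr (_ + _); rewrite mxE.
  by rewrite distrC; exact: zJ.
rewrite !sumr_const !card_ord -mulrnA -mulr_natl mulrA ler_wpM2r ?euclid_norm_ge0//.
rewrite mulrCA ger_pMr// ler_pdivrMr// mul1r ler_nat mulnC leqW//.
Unshelve. all: by end_near. Qed.

End mean_value.

(** * Almost linear charts *)

Section jacobian_factor.
Variable R : realType.

(** The Leibniz formula makes the determinant a polynomial in the entries of the
    jacobian. *)
Lemma jfactor_continuous d m (h : 'rV[R]_d -> 'rV[R]_m) :
  continuously_differentiable h -> continuous (jfactor h).
Proof.
move=> hC1.
pose e i j z : R := \sum_k jacobian h z k i * jacobian h z k j.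
have eE z i j : (Jmx h z *m (Jmx h z)^T) i j = e i j z.
  rewrite [LHS]mxE; apply: eq_bigr => k _; congr (_ * _); first by rewrite /Jmx mxE.
  by rewrite mxE /Jmx mxE.
have -> : jfactor h = fun z => Num.sqrt (\sum_(s : 'S_m) (-1) ^+ s * \prod_i e i (s i) z).
  apply/funext => z; rewrite /jfactor /determinant; congr Num.sqrt.
  by apply: eq_bigr => s _; congr (_ * _); apply: eq_bigr => i _; exact: eE.
have ce i j : continuous (e i j).
  apply: continuous_big => [|k _]; first exact: add_continuous.
  move=> x; exact: (cvgM (@jacobian_coord_continuous R d m h k i hC1 x)
    (@jacobian_coord_continuous R d m h k j hC1 x)).
have cprod (s : 'S_m) : continuous (fun z => \prod_i e i (s i) z : R).
  by apply: continuous_big => [|i _]; [exact: mul_continuous|exact: ce].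
have cdet : continuous (fun z => \sum_(s : 'S_m) (-1) ^+ s * \prod_i e i (s i) z : R).
  apply: continuous_big => [|s _ x]; first exact: add_continuous.
  exact: (cvgM (cvg_cst _) (cprod s x)).
by move=> x; apply: continuous_comp; [exact: cdet|exact: sqrt_continuous].
Qed.

Lemma jfactor_ge0 d m (h : 'rV[R]_d -> 'rV[R]_m) x : 0 <= jfactor h x.
Proof. exact: sqrtr_ge0. Qed.

End jacobian_factor.

Section injective_images.
Variable R : realType.

(** An elementary case of the Lusin-Souslin theorem: since [f] is injective on the
    compact set [K], images of relative complements are complements of images, so the
    sets whose trace on [K] has a Borel image form a sigma-algebra. *)
Lemma borel_injective_image a b (f : 'rV[R]_a -> 'rV[R]_b) (K : set 'rV[R]_a)
    (E : set (borelRV R a)) :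
  continuous f -> compact K -> (forall x y, K x -> K y -> f x = f y -> x = y) ->
  measurable E -> E `<=` K -> measurable (f @` E : set (borelRV R b)).
Proof.
move=> cf cK fK mE EK.
have mcompact C : compact C -> measurable (f @` C : set (borelRV R b)).
  move=> cC; apply: compact_borel; apply: continuous_compact => //.
  exact: continuous_subspaceT.
have fD A B : A `<=` K -> B `<=` A -> f @` (A `\` B) = f @` A `\` f @` B.
  move=> AK BA; apply/seteqP; split => [_ [x [Ax nBx] <-]|_ [[x Ax <-] nfB]].
    split; first by exists x.
    by move=> [y By fyx]; apply: nBx; rewrite -(fK _ _ (AK _ (BA _ By)) (AK _ Ax) fyx).
  by exists x => //; split => // Bx; apply: nfB; exists x.
suff : <<s @open 'rV[R]_a >> `<=`
    [set B : set 'rV[R]_a | measurable (f @` (K `&` B) : set (borelRV R b))].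
  by move=> /(_ _ mE)/=; rewrite setIidr.
apply: smallest_sub.
  split => /=.
  - by rewrite setI0 image_set0; exact: measurable0.
  - move=> B mB; rewrite setTD (_ : K `&` ~` B = K `\` (K `&` B)).
      by rewrite fD//; apply: measurableD => //; exact: mcompact.
    apply/seteqP; split => x [Kx nB]; split => //; first by case.
    by move=> Bx; apply: nB.
  - move=> F mF; rewrite setI_bigcupr image_bigcup; exact: bigcupT_measurable.
move=> U oU /=; rewrite (_ : K `&` U = K `\` (K `&` ~` U)).
  rewrite fD//; apply: measurableD; first exact: mcompact.
  apply: mcompact; apply: compact_closedI => //; exact: open_closedC.
apply/seteqP; split => x [Kx HU]; split => //; first by case.
by apply: contrapT => nU; apply: HU.
Qed.

End injective_images.

Section almost_linear.
Variable R : realType.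

(** Several errors of factor [mu] will be multiplied; this chooses [mu] so that they
    stay within [lam] together. *)
Lemma exists_small_root (n : nat) (lam : R) : 1 < lam ->
  exists2 mu, 1 < mu & mu ^+ n <= lam.
Proof.
move=> lam1; have lam0 : 0 < lam by exact: lt_trans lam1.
exists (expR (ln lam / n.+1%:R)).
  by rewrite expR_gt1 divr_gt0// ln_gt0.
rewrite -expRM_natl -[leRHS](@lnK R) ?posrE// ler_expR mulrCA ler_piMr//.
  by rewrite ltW// ln_gt0.
by rewrite ler_pdivrMr// mul1r ler_nat.
Qed.

Lemma near_multiplicatively_close n (f : 'rV[R]_n -> R) x0 (lam : R) :
  f @ x0 --> f x0 -> 0 < f x0 -> 1 < lam ->
  \forall r \near 0^'+, forall x, ball x0 r x -> f x <= lam * f x0 /\ f x0 <= lam * f x.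
Proof.
move=> cf f0 lam1; have lam0 : 0 < lam by exact: lt_trans lam1.
have lf : f x0 < lam * f x0 by rewrite ltr_pMl.
have fl : lam^-1 * f x0 < f x0 by rewrite gtr_pMl// invf_lt1.
have /nbhs_ballP[r /= r0 rH] : nbhs x0 [set x | f x < lam * f x0 /\ lam^-1 * f x0 < f x].
  by apply: filterI; [exact: (cvgr_lt _ cf)|exact: (cvgr_gt _ cf)].
near=> s; move=> x xs; have /rH[fx xf] : ball x0 r x.
  by apply: le_ball xs; near: s; exact: nbhs_right_le.
by split; [exact: ltW|rewrite -ler_pdivrMl// ltW].
Unshelve. all: by end_near. Qed.

(** [Psi x - Psi y] differs from [x - y] by [(h x - h y - (x - y) J, 0) M^-1], which
    strict differentiability makes small relative to [x - y]. *)
Lemma local_almost_linear m k (h : 'rV[R]_(m + k) -> 'rV[R]_m) x0 (lam : R) :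
  continuously_differentiable h -> 0 < jfactor h x0 -> 1 < lam ->
  exists (L : 'M[R]_(m + k, k)) (r : R),
    let M := row_mx (jacobian h x0) L in
    let Psi x := row_mx (h x) (x *m L) *m invmx M in
    [/\ 0 < r, L^T *m L = 1%:M, (jacobian h x0)^T *m L = 0,
     forall x y, box (x0 - const_mx r) (2 * r) x -> box (x0 - const_mx r) (2 * r) y ->
       euclid_norm (x - y) <= lam * euclid_norm (Psi x - Psi y) /\
       euclid_norm (Psi x - Psi y) <= lam * euclid_norm (x - y) &
     forall x, box (x0 - const_mx r) (2 * r) x ->
       jfactor h x <= lam * jfactor h x0 /\ jfactor h x0 <= lam * jfactor h x].
Proof.
move=> hC1 j0 lam1; have lam0 : 0 < lam by exact: lt_trans lam1.
(* x M = (x J, x L), so the first m coordinates are the derivative of h *)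
have [L [LL JL]] := orthonormal_completion (jacobian h x0) (leqnn (m + k)).
set M := row_mx (jacobian h x0) L.
have detM : `|\det M| = jfactor h x0.
  by rewrite normr_det_row_mx// /jfactor /Jmx trmxK.
have uM : M \in unitmx by rewrite unitmxE unitfE -normr_gt0 detM.
have [C C0 HC] := euclid_norm_mulmx_bound (invmx M).
(* 1 - eta = 1 / lam, and 1 + eta <= lam since lam + 1 / lam >= 2 *)
pose eta := 1 - lam^-1.
have eta0 : 0 < eta by rewrite subr_gt0 invf_lt1.
have nearj : \forall r \near 0^'+, forall x, ball x0 r x ->
    jfactor h x <= lam * jfactor h x0 /\ jfactor h x0 <= lam * jfactor h x.
  have cj : jfactor h @ x0 --> jfactor h x0 by exact: jfactor_continuous.
  exact: near_multiplicatively_close cj j0 lam1.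
have nearh := C1_strict_differentiability x0 hC1 (divr_gt0 eta0 C0).
have [s [s0 sj sh]] : exists s, [/\ 0 < s,
    forall x, ball x0 s x ->
      jfactor h x <= lam * jfactor h x0 /\ jfactor h x0 <= lam * jfactor h x &
    forall x y, ball x0 s x -> ball x0 s y ->
      euclid_norm (h x - h y - (x - y) *m jacobian h x0) <=
      eta / C * euclid_norm (x - y)].
  near (0 : R)^'+ => s; exists s; split => //.
  - by near: s; exact: nearj.
  - by near: s; exact: nearh.
have box_ball x : box (x0 - const_mx (s / 2)) (2 * (s / 2)) x -> ball x0 s x.
  move=> bx; split => // i j; rewrite ord1 /ball/=.
  have := bx j; rewrite !mxE => /andP[? ?].
  by rewrite ltr_norml; apply/andP; split; lra.
exists L, (s / 2) => /=; split => //; [by rewrite divr_gt0| |by move=> x /box_ball/sj].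
move=> x y /box_ball xs /box_ball ys; rewrite -/M -mulmxBl.
set D := (_ *m invmx M).
pose u := h x - h y - (x - y) *m jacobian h x0.
have uE : (x - y) *m jacobian h x0 + u = h x - h y by rewrite addrC subrK.
have DE : D = (x - y) + row_mx u 0 *m invmx M.
  rewrite -[x - y in RHS](mulmxK uM) -mulmxDl {2}/M mul_mx_row add_row_mx addr0 uE.
  by rewrite /D opp_row_mx add_row_mx mulmxBl.
have De : euclid_norm (D - (x - y)) <= eta * euclid_norm (x - y).
  rewrite DE addrC addKr (le_trans (HC _))//.
  have -> : euclid_norm (row_mx u 0 : 'rV[R]_(m + k)) = euclid_norm u.
    rewrite /euclid_norm big_split_ord/= [X in _ + X]big1 ?addr0.
      by congr Num.sqrt; apply: eq_bigr => i _; rewrite row_mxEl.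
    by move=> i _; rewrite row_mxEr mxE expr0n.
  by rewrite -ler_pdivlMl// mulrA (mulrC _^-1) /u sh.
have e0 := euclid_norm_ge0 (x - y).
have lamV : lam^-1 * lam = 1 by rewrite mulVf// gt_eqF.
have lamV0 : 0 < lam^-1 by rewrite invr_gt0.
split.
  have := ler_euclid_normD D (- (D - (x - y))).
  rewrite euclid_normN opprB (addrC D) subrK => H.
  have : lam^-1 * euclid_norm (x - y) <= euclid_norm D by rewrite /eta in De; lra.
  by rewrite ler_pdivrMl.
have := ler_euclid_normD (D - (x - y)) (x - y); rewrite subrK => H.
apply: (le_trans H); apply: (@le_trans _ _ ((1 + eta) * euclid_norm (x - y))).
  by rewrite mulrDl mul1r addrC lerD2l.
by rewrite ler_wpM2r// /eta; nra.
Unshelve. all: by end_near. Qed.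

End almost_linear.

(** * The local coarea estimate *)

Lemma integral_near_constant (R : realType) n (E : set (borelRV R n)) (j : 'rV[R]_n -> R)
    (c mu : R) :
  measurable E -> measurable_fun E (EFin \o j) -> (forall x, E x -> 0 <= j x) ->
  0 <= c -> 0 <= mu -> (forall x, E x -> j x <= mu * c /\ c <= mu * j x) ->
  (\int[@leb R n]_(x in E) (j x)%:E <= mu%:E * (c%:E * leb E))%E /\
  (c%:E * leb E <= mu%:E * \int[@leb R n]_(x in E) (j x)%:E)%E.
Proof.
move=> mE mj j0 c0 mu0 jc; split.
  rewrite muleA -EFinM -integral_cst//; apply: ge0_le_integral => //.
  by move=> x Ex /=; rewrite lee_fin; exact: (jc x Ex).1.
rewrite -integral_cst// -ge0_integralZl//.
apply: ge0_le_integral => //.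
- by apply: measurable_funeM; exact: mj.
- by move=> x Ex /=; rewrite -EFinM lee_fin; exact: (jc x Ex).2.
Qed.

Section coarea_approximation.
Variables (R : realType) (m k : nat).
Implicit Types (h : 'rV[R]_(m + k) -> 'rV[R]_m) (E : set (borelRV R (m + k))).

(** The coarea formula for [E] up to the factor [lam].  The auxiliary [G] stands for the
    measures of the fibres, whose measurability is not known at this stage and only
    follows by letting [lam] tend to [1]. *)
Definition coarea_approx (lam : R) h E :=
  exists G : borelRV R m -> \bar R,
    [/\ measurable_fun setT G, forall y, (0 <= G y)%E,
      forall y, (G y <= lam%:E * hausdorff k (E `&` h @^-1` [set y]))%E /\
                (hausdorff k (E `&` h @^-1` [set y]) <= lam%:E * G y)%E,
      (\int[@leb R m]_y G y <= lam%:E * \int[@leb R _]_(x in E) (jfactor h x)%:E)%E &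
      (\int[@leb R _]_(x in E) (jfactor h x)%:E <= lam%:E * \int[@leb R m]_y G y)%E].

Lemma measurable_jfactor h (D : set (borelRV R (m + k))) :
  continuously_differentiable h -> measurable_fun D (EFin \o jfactor h).
Proof.
move=> hC1; apply: (@measurable_funS _ _ _ _ setT) => //.
by apply/measurable_EFinP; apply: continuous_borel_real; exact: jfactor_continuous.
Qed.

Lemma C1_continuous h : continuously_differentiable h -> continuous h.
Proof. by move=> hC1 x; apply: differentiable_continuous; exact: hC1.1. Qed.

(** [G y] is the measure of the section at [y] of the image of [E] by
    [Phi x = (h x, x L)].  It is the Hausdorff measure of the projection by [L] of the
    fibre, and Fubini and the linear change of variables compute its integral. *)
Lemma local_coarea_approx h x0 (lam : R) :
  continuously_differentiable h -> 0 < jfactor h x0 -> 1 < lam ->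
  exists2 r : R, 0 < r & forall E, measurable E -> E `<=` ball x0 r -> coarea_approx lam h E.
Proof.
move=> hC1 j0 lam1.
(* mu ^+ (m + k) for the volumes of Psi, one more mu for the Jacobian factor *)
have [mu mu1 mulam] := exists_small_root (m + k).+1 lam1.
have mu0 : 0 < mu by exact: lt_trans mu1.
have mu_ge0 n : (0 <= (mu ^+ n)%:E)%E by rewrite lee_fin exprn_ge0// ltW.
have [L [r]] := local_almost_linear hC1 j0 mu1.
set M := row_mx (jacobian h x0) L; pose Phi x := row_mx (h x) (x *m L).
pose K := box (x0 - const_mx r) (2 * r).
move=> /= [r0 LL JL KPsi Kj]; exists r => // E mE EB.
have EK : E `<=` K.
  move=> x /EB[_ xr] i; have := xr ord0 i; rewrite /ball/= !mxE ltr_norml.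
  by move=> /andP[? ?]; apply/andP; split; lra.
have detM : `|\det M| = jfactor h x0.
  by rewrite normr_det_row_mx// /jfactor /Jmx trmxK.
have uM : M \in unitmx by rewrite unitmxE unitfE -normr_gt0 detM.
pose Psi x := Phi x *m invmx M.
have PsiM x : Psi x *m M = Phi x by rewrite mulmxKV.
have Psi_inj x y : K x -> K y -> Psi x = Psi y -> x = y.
  move=> Kx Ky Pxy; apply/eqP; rewrite -subr_eq0; apply/eqP/euclid_norm_eq0/eqP.
  rewrite eq_le euclid_norm_ge0 andbT (le_trans (KPsi _ _ Kx Ky).1)//.
  by rewrite -/(Psi x) -/(Psi y) Pxy subrr euclid_norm0 mulr0.
have cPhi : continuous Phi.
  move=> x; apply: (@continuous_comp _ _ _ (fun x => (h x, x *m L)) (fun p => row_mx p.1 p.2)).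
    have ch : h @ x --> h x by exact: C1_continuous.
    have cL : (fun x => x *m L) @ x --> x *m L by exact: mulmx_rV_continuous.
    exact: cvg_pair ch cL.
  exact: row_mx_continuous.
have mPhiE : measurable (Phi @` E : set (borelRV R (m + k))).
  apply: (borel_injective_image cPhi (@compact_box R _ _ _) _ mE EK) => x y Kx Ky Pxy.
  by apply: Psi_inj => //; rewrite /Psi Pxy.
(* Phi E is the image of Psi E by M, so the linear change of variables applies *)
have PsiE : Psi @` E = [set x | (Phi @` E) (x *m M)].
  apply/seteqP; split => [_ [x Ex <-]/=|y [x Ex xy]]; first by exists x; rewrite ?PsiM.
  by exists x => //; rewrite /Psi xy mulmxK.
have mPsiE : measurable (Psi @` E : set (borelRV R (m + k))).
  by rewrite PsiE; exact: measurable_mulmx_preimage.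
pose G y := leb [set z : 'rV[R]_k | (Phi @` E) (row_mx y z)].
have GE y : G y = hausdorff k ((fun x => x *m L) @` (E `&` h @^-1` [set y])).
  rewrite /G -hausdorff_leb; last exact: measurable_section.
  congr (hausdorff _ _); apply/seteqP; split => [z [x Ex /eq_row_mx[hx xz]]|_ [x [Ex hx] <-]].
    by exists x.
  by exists x => //; rewrite /Phi hx.
(* on a fibre of h the map Psi is the isometric image of the projection by L *)
have fibre_isometry x y : h x = h y ->
    euclid_norm (Psi x - Psi y) = euclid_norm (x *m L - y *m L).
  move=> hxy; set z := x *m L - y *m L.
  rewrite -(euclid_norm_mul_orth z LL); congr euclid_norm.
  apply: (can_inj (mulmxK uM)).
  have -> : (Psi x - Psi y) *m M = row_mx 0 z.
    rewrite [LHS]mulmxBl !PsiM /Phi opp_row_mx add_row_mx hxy subrr.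
    by [].
  rewrite /M mul_mx_row -!mulmxA LL mulmx1 -[L^T *m _]trmxK trmx_mul trmxK JL.
  by rewrite trmx0 mulmx0.
have mukd n : (n <= (m + k).+1)%N -> ((mu ^+ n)%:E <= lam%:E)%E.
  move=> nd; rewrite lee_fin (le_trans _ mulam)// ler_weXn2l// ltW//.
have intG : (\int[@leb R m]_y G y = (jfactor h x0)%:E * leb (Psi @` E))%E.
  rewrite -leb_prod// PsiE leb_mulmx_preimage// detM muleA -EFinM mulfV ?mul1e//.
  by rewrite gt_eqF.
have lebPsi : (leb (Psi @` E) <= (mu ^+ (m + k))%:E * leb E)%E.
  rewrite -!hausdorff_leb//; apply: hausdorff_lipschitz => // x y Ex Ey.
  by apply: (KPsi _ _ _ _).2; exact: EK.
have lebE : (leb E <= (mu ^+ (m + k))%:E * leb (Psi @` E))%E.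
  rewrite -!hausdorff_leb//; apply: hausdorff_expanding => // x y Ex Ey.
  by apply: (KPsi _ _ _ _).1; exact: EK.
have j0_ge0 : (0 <= (jfactor h x0)%:E)%E by rewrite lee_fin ltW.
have mj := @measurable_jfactor h E hC1.
have [Jle leJ] := integral_near_constant mE mj (fun x _ => jfactor_ge0 h x)
  (ltW j0) (ltW mu0) (fun x Ex => Kj x (EK x Ex)).
have J0 : (0 <= \int[@leb R _]_(x in E) (jfactor h x)%:E)%E.
  by apply: integral_ge0 => x _; rewrite lee_fin jfactor_ge0.
rewrite /coarea_approx; move: J0 Jle leJ.
move: (\int[_]_(x in E) _)%E => J J0 Jle leJ.
exists G; split.
- exact: measurable_leb_section.
- by move=> y; exact: measure_ge0.
- move=> y; rewrite GE; split.
    apply: (@le_trans _ _ ((mu ^+ k)%:E * hausdorff k (E `&` h @^-1` [set y]))%E).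
      apply: hausdorff_lipschitz => // a b [Ea ha] [Eb hb].
      rewrite -fibre_isometry ?ha ?hb//.
      by apply: (KPsi _ _ _ _).2; exact: EK.
    rewrite lee_wpmul2r ?(outer_measure_ge0 (@hausdorff R _ k))//.
    by apply: mukd; rewrite leqW// leq_addl.
  set F := (_ @` _).
  apply: (@le_trans _ _ ((mu ^+ k)%:E * hausdorff k F)%E).
    apply: hausdorff_expanding => // a b [Ea ha] [Eb hb].
    rewrite -fibre_isometry ?ha ?hb//.
    by apply: (KPsi _ _ _ _).1; exact: EK.
  rewrite lee_wpmul2r ?(outer_measure_ge0 (@hausdorff R _ k))//.
  by apply: mukd; rewrite leqW// leq_addl.
- rewrite intG; apply: (le_trans (lee_wpmul2l j0_ge0 lebPsi)).
  rewrite muleCA; apply: (le_trans (lee_wpmul2l (mu_ge0 _) leJ)).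
  by rewrite muleA -EFinM -exprSr lee_wpmul2r// mukd.
- rewrite intG; apply: (le_trans Jle).
  apply: (@le_trans _ _ (mu%:E * ((jfactor h x0)%:E *
      ((mu ^+ (m + k))%:E * leb (Psi @` E))))%E).
    apply: lee_wpmul2l; first by rewrite lee_fin ltW.
    exact: lee_wpmul2l.
  rewrite (muleCA _ (mu ^+ (m + k))%:E) [leLHS]muleA -EFinM -exprS.
  by apply: lee_wpmul2r; [exact: mule_ge0|exact: mukd].
Qed.

End coarea_approximation.

(** * The coarea formula for Borel sets *)

Section coarea_borel_sets.
Variables (R : realType) (m k : nat) (h : 'rV[R]_(m + k) -> 'rV[R]_m).
Hypothesis hC1 : continuously_differentiable h.
Implicit Types E : set (borelRV R (m + k)).
Local Open Scope ereal_scope.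

Let fibre E y := hausdorff k (E `&` h @^-1` [set y]).
Let J E := \int[@leb R _]_(x in E) (jfactor h x)%:E.

Let fibre_ge0 E y : 0 <= fibre E y.
Proof. exact: (outer_measure_ge0 (@hausdorff R _ k)). Qed.

Let J_ge0 E : 0 <= J E.
Proof. by apply: integral_ge0 => x _; rewrite lee_fin jfactor_ge0. Qed.

Lemma measurable_fibre y : measurable (h @^-1` [set y] : set (borelRV R (m + k))).
Proof.
apply: closed_borel; apply: preimage_closed.
  by move=> x _; exact: C1_continuous.
by apply: accessible_closed_set1; apply: hausdorff_accessible; exact: norm_hausdorff.
Qed.

Lemma measurable_preimage_C1 (A : set (borelRV R m)) : measurable A ->
  measurable (h @^-1` A : set (borelRV R (m + k))).
Proof.
move=> mA; rewrite -[X in measurable X]setTI.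
by apply: (@continuous_borel R (m + k) m h) => //; exact: C1_continuous.
Qed.

Lemma fibre_bigcup (F : (set (borelRV R (m + k)))^nat) y :
  (forall i, measurable (F i)) -> trivIset setT F ->
  fibre (\bigcup_i F i) y = \sum_(i <oo) fibre (F i) y.
Proof.
move=> mF tF; rewrite /fibre setI_bigcupl.
apply/esym/cvg_lim => //.
apply: (@measure_semi_sigma_additive _ _ _ (hausdorff_borel R (m + k) k)
  (fun i => F i `&` h @^-1` [set y])).
- by move=> i; apply: measurableI => //; exact: measurable_fibre.
- exact: trivIset_setIr.
- by apply: bigcupT_measurable => i; apply: measurableI => //; exact: measurable_fibre.
Qed.

Lemma integral_jfactor_bigcup (F : (set (borelRV R (m + k)))^nat) :
  (forall i, measurable (F i)) -> trivIset setT F ->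
  J (\bigcup_i F i) = \sum_(i <oo) J (F i).
Proof.
move=> mF tF; apply: ge0_integral_bigcup => //.
- exact: measurable_jfactor.
- by move=> x _; rewrite lee_fin jfactor_ge0.
Qed.

Lemma coarea_approx_bigcup (lam : R) (F : (set (borelRV R (m + k)))^nat) :
  (forall i, measurable (F i)) -> trivIset setT F ->
  (forall i, coarea_approx lam h (F i)) -> coarea_approx lam h (\bigcup_i F i).
Proof.
move=> mF tF /choice[G HG].
have mG i : measurable_fun setT (G i) by have [] := HG i.
have G0 i y : 0 <= G i y by have [_ /(_ y)] := HG i.
exists (fun y => \sum_(i <oo) G i y).
have intG : \int[@leb R m]_y (\sum_(i <oo) G i y) = \sum_(i <oo) \int[@leb R m]_y G i y.
  by rewrite integral_nneseries.
have intG0 i : 0 <= \int[@leb R m]_y G i y by apply: integral_ge0 => y _; exact: G0.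
have fF := fun y => fibre_bigcup y mF tF; have JF := integral_jfactor_bigcup mF tF.
split.
- apply: ge0_emeasurable_sum => //.
- by move=> y; apply: nneseries_ge0 => i _ _; exact: G0.
- move=> y; change ((\sum_(i <oo) G i y <= lam%:E * fibre (\bigcup_i F i) y) /\
    (fibre (\bigcup_i F i) y <= lam%:E * \sum_(i <oo) G i y)).
  rewrite fF -!nneseriesZl//; split; apply: lee_nneseries => // i _.
  + by have [_ _ /(_ y)[]] := HG i.
  + by have [_ _ /(_ y)[]] := HG i.
- rewrite intG; change (\sum_(i <oo) \int[@leb R m]_y G i y <= lam%:E * J (\bigcup_i F i)).
  rewrite JF -!nneseriesZl//; apply: lee_nneseries => // i _.
  by have [] := HG i.
- rewrite intG; change (J (\bigcup_i F i) <= lam%:E * \sum_(i <oo) \int[@leb R m]_y G i y).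
  rewrite JF -!nneseriesZl//; apply: lee_nneseries => // i _.
  by have [] := HG i.
Qed.

Lemma coarea_approx_set0 (lam : R) : coarea_approx lam h set0.
Proof.
exists (cst 0); split => //.
- move=> y; rewrite set0I (outer_measure0 (@hausdorff R _ k)) mule0; split => //.
- by rewrite integral_set0 mule0 integral0.
- by rewrite integral_set0 integral0 mule0.
Qed.

(** A countable cover of the open set by rational balls suffices; made disjoint, it
    partitions [E] into pieces to which the local estimate applies. *)
Lemma coarea_approx_open (Omega : set 'rV[R]_(m + k)) E (lam : R) :
  open Omega -> (forall x, Omega x -> (0 < jfactor h x)%R) -> (1 < lam)%R ->
  measurable E -> E `<=` Omega -> coarea_approx lam h E.
Proof.
move=> oO j0 lam1 mE EO.
pose good (B : set 'rV[R]_(m + k)) :=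
  forall E', measurable E' -> E' `<=` B -> coarea_approx lam h E'.
pose rball (q : 'rV[rat]_(m + k) * nat) : set 'rV[R]_(m + k) :=
  ball (map_mx ratr q.1 : 'rV[R]_(m + k)) q.2.+1%:R^-1.
pose B i : set (borelRV R (m + k)) :=
  if unpickle i is Some q then (if pselect (good (rball q)) then rball q else set0) else set0.
have good0 : good set0.
  move=> E' _ E'0; have -> : E' = set0 by apply/seteqP; split.
  exact: coarea_approx_set0.
have goodB i : good (B i).
  by rewrite /B; case: unpickle => // q; case: pselect.
have mB i : measurable (B i).
  rewrite /B; case: unpickle => [q|]; last exact: measurable0.
  case: pselect => ?; last exact: measurable0.
  by apply: open_borel; exact: ball_open.
have EB : E `<=` \bigcup_i B i.
  move=> x0 /EO/j0 jx0; have [r r0 rgood] := local_coarea_approx hC1 jx0 lam1.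
  have [n nr] : exists n, (n.+1%:R^-1 < r / 2)%R.
    have r20 : (0 < r / 2)%R by rewrite divr_gt0.
    exists (Num.truncn (r / 2)^-1); rewrite invf_plt ?posrE// ?invr_gt0//.
    exact: truncnS_gt.
  have n0 : (0 < n.+1%:R^-1 :> R)%R by rewrite invr_gt0.
  have [q qx] := ratr_rV_near x0 n0.
  exists (pickle (q, n)) => //; rewrite /B pickleK; case: pselect => [?|[]]; first exact: qx.
  move=> E' mE' E'B; apply: rgood => // x /E'B qx'.
  have nr' : (n.+1%:R^-1 + n.+1%:R^-1 <= r)%R by rewrite (splitr r) lerD// ltW.
  by apply: (le_ball nr'); apply: ball_triangle (ball_sym qx) qx'.
have -> : E = \bigcup_i (E `&` seqDU B i).
  by rewrite -setI_bigcupr -seqDU_bigcup_eq setIidl.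
apply: coarea_approx_bigcup.
- by move=> i; apply: measurableI => //; exact: seqDU_measurable.
- by apply: trivIset_setIl; exact: trivIset_seqDU.
- move=> i; apply: (goodB i).
    by apply: measurableI => //; exact: seqDU_measurable.
  by move=> x [_ []].
Qed.

Lemma lee_mulgt1 (x y : \bar R) : 0 <= x ->
  (forall lam : R, (1 < lam)%R -> x <= lam%:E * y) -> x <= y.
Proof.
move=> x0 xy; apply/lee_mul01Pr => // r /andP[r0 r1].
by rewrite -lee_pdivlMl//; apply: xy; rewrite invf_gt1.
Qed.

(** The measure of a fibre is the infimum over [n] of the approximations [a n * G n y]
    with [a n] tending to [1], hence measurable in [y]; then the integrals agree up to
    every factor [lam > 1]. *)
Lemma coarea_borel_set (Omega : set 'rV[R]_(m + k)) E :
  open Omega -> (forall x, Omega x -> (0 < jfactor h x)%R) ->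
  measurable E -> E `<=` Omega ->
  measurable_fun setT ((fun y => hausdorff k (E `&` h @^-1` [set y])) : borelRV R m -> \bar R) /\
  \int[@leb R m]_y hausdorff k (E `&` h @^-1` [set y]) =
  \int[@leb R _]_(x in E) (jfactor h x)%:E.
Proof.
move=> oO j0 mE EO.
have approx lam : (1 < lam)%R -> coarea_approx lam h E.
  by move=> lam1; exact: coarea_approx_open oO j0 lam1 mE EO.
pose a n : R := (1 + n.+1%:R^-1)%R.
have a1 n : (1 < a n)%R by rewrite ltrDl invr_gt0.
have a0 n : 0 <= (a n)%:E by rewrite lee_fin ltW// (lt_trans _ (a1 n)).
have [G HG] := choice (fun n => approx _ (a1 n)).
have mfib : measurable_fun setT (fibre E : borelRV R m -> \bar R).
  have -> : fibre E = (fun y => einfs (fun n => (a n)%:E * G n y) 0%N).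
    apply/funext => y; apply/eqP; rewrite eq_le; apply/andP; split.
      apply: le_ereal_inf_tmp => _ [n _ <-].
      by have [_ _ /(_ y)[]] := HG n.
    apply: lee_mulgt1.
      apply: le_ereal_inf_tmp => _ [n _ <-]; apply: mule_ge0 => //.
      by have [_ /(_ y)] := HG n.
    move=> lam lam1; have [mu mu1 mulam] := exists_small_root 2 lam1.
    have [n nmu] : exists n, (a n <= mu)%R.
      have mu0 : (0 < mu - 1)%R by rewrite subr_gt0.
      exists (Num.truncn (mu - 1)^-1); rewrite /a -lerBrDl ltW//.
      by rewrite invf_plt ?posrE ?invr_gt0// truncnS_gt.
    apply: (@le_trans _ _ ((a n)%:E * G n y)).
      by apply: ereal_inf_lbound; exists n.
    have [_ _ /(_ y)[Gy _] _ _] := HG n.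
    apply: (le_trans (lee_wpmul2l (a0 n) Gy)).
    rewrite muleA -EFinM; apply: lee_wpmul2r; first exact: fibre_ge0.
    rewrite lee_fin (le_trans _ mulam)// expr2 ler_pM// -lee_fin; exact: a0.
  apply: (measurable_fun_einfs (f := fun n y => (a n)%:E * G n y)) => n.
  by apply: measurable_funeM; have [] := HG n.
split=> //.
have int_ge0 : 0 <= \int[@leb R m]_y fibre E y.
  by apply: integral_ge0 => y _; exact: fibre_ge0.
change (\int[@leb R m]_y fibre E y = J E).
apply/eqP; rewrite eq_le; apply/andP; split; apply: lee_mulgt1 => // lam lam1;
  have [mu mu1 mulam] := exists_small_root 2 lam1;
  have mu0 : 0 <= mu%:E by rewrite lee_fin ltW// (lt_trans _ mu1)//.
- have [H [mH H0 HE HJ JH]] := approx _ mu1.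
  apply: (@le_trans _ _ (\int[@leb R m]_y (mu%:E * H y))).
    apply: ge0_le_integral => //.
      by apply: measurable_funeM.
    by move=> y _; exact: (HE y).2.
  rewrite ge0_integralZl//; apply: (le_trans (lee_wpmul2l mu0 HJ)).
  by rewrite muleA -EFinM; apply: lee_wpmul2r; [exact: J_ge0|rewrite -expr2 lee_fin].
- have [H [mH H0 HE HJ JH]] := approx _ mu1.
  apply: (le_trans JH); rewrite -/(fibre E).
  apply: (@le_trans _ _ (mu%:E * \int[@leb R m]_y (mu%:E * fibre E y))).
    apply: lee_wpmul2l => //; apply: ge0_le_integral => //.
      by apply: measurable_funeM.
    by move=> y _; exact: (HE y).1.
  rewrite ge0_integralZl//.
  by rewrite muleA -EFinM; apply: lee_wpmul2r; [exact: int_ge0|rewrite -expr2 lee_fin].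
Qed.

End coarea_borel_sets.

(** * From sets to functions *)

Section disintegration.
Local Open Scope ereal_scope.
Import HBNNSimple.

Lemma integral_nnsfun_fsum d (T : measurableType d) (R : realType)
    (mu : {measure set T -> \bar R}) (D : set T) (g : {nnsfun T >-> R}) :
  measurable D ->
  \int[mu]_(x in D) (g x)%:E =
  \sum_(r \in range g) r%:E * mu (g @^-1` [set r] `&` D).
Proof.
move=> mD; under eq_integral do rewrite fimfunE -fsumEFin//.
rewrite ge0_integral_fsum//; last 2 first.
- by move=> r; exact/measurable_EFinP/measurable_funM.
- by move=> r x _; exact: nnfun_muleindic_ge0.
by apply: eq_fsbigr => r _; rewrite integralZl_indic_nnsfun// integral_indic.
Qed.

Lemma integral_nnsfun_density_fsum d (T : measurableType d) (R : realType)
    (nu : {measure set T -> \bar R}) (D : set T) (g : {nnsfun T >-> R})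
    (j : T -> \bar R) :
  measurable D -> measurable_fun setT j -> (forall x, 0 <= j x) ->
  \int[nu]_(x in D) ((g x)%:E * j x) =
  \sum_(r \in range g) r%:E * \int[nu]_(x in g @^-1` [set r] `&` D) j x.
Proof.
move=> mD mj j0.
have gE x : (g x)%:E * j x = \sum_(r \in range g) (r * \1_(g @^-1` [set r]) x)%:E * j x.
  by rewrite [in LHS]fimfunE -fsumEFin// ge0_mule_fsuml// => r; exact: nnfun_muleindic_ge0.
under eq_integral do rewrite gE.
rewrite ge0_integral_fsum//; last 2 first.
- move=> r; apply: emeasurable_funM; last exact: measurable_funS mj.
  exact/measurable_EFinP/measurable_funM.
- by move=> r x _; rewrite mule_ge0//; exact: nnfun_muleindic_ge0.
apply: eq_fsbigr => r; rewrite inE => -[t _ <-].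
have gt0 : 0 <= (g t)%:E by rewrite lee_fin.
have mgD : measurable (g @^-1` [set g t] `&` D) by exact: measurableI.
rewrite -ge0_integralZl//; last exact: measurable_funS mj.
rewrite integral_mkcondl; apply: eq_integral => x _; rewrite /patch indicE EFinM -muleA.
by case: ifPn => xg; rewrite ?mul1e ?mul0e ?mule0.
Qed.

(** The hypothesis on sets is the case of indicator functions; linearity gives simple
    functions, and monotone convergence, used once in the fibres and once for each of
    the two outer integrals, gives all nonnegative measurable ones. *)
Lemma ge0_integral_disintegration d d' (T : measurableType d) (Y : measurableType d')
    (R : realType) (mu nu : {measure set T -> \bar R}) (la : {measure set Y -> \bar R})
    (D : Y -> set T) (Omega : set T) (j : T -> R) (f : T -> \bar R) :
  (forall y, measurable (D y)) -> measurable Omega ->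
  measurable_fun setT (EFin \o j) -> (forall x, 0 <= j x)%R ->
  measurable_fun setT f -> (forall x, 0 <= f x) ->
  (forall E, measurable E -> measurable_fun setT (fun y => mu (E `&` D y)) /\
     \int[la]_y mu (E `&` D y) = \int[nu]_(x in E `&` Omega) (j x)%:E) ->
  measurable_fun setT (fun y => \int[mu]_(x in D y) f x) /\
  \int[la]_y (\int[mu]_(x in D y) f x) = \int[nu]_(x in Omega) (f x * (j x)%:E).
Proof.
move=> mD mO mj j0 mf f0 H.
pose g := nnsfun_approx measurableT mf.
have mg n : measurable_fun setT (EFin \o g n) by exact/measurable_EFinP.
have g0 n x : 0 <= (g n x)%:E by rewrite lee_fin.
have ndg x : {homo (fun n => (g n x)%:E) : a b / (a <= b)%N >-> a <= b}.
  by move=> a b ab; rewrite lee_fin; exact/lefP/nd_nnsfun_approx.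
have gf x : (g n x)%:E @[n --> \oo] --> f x by exact: cvg_nnsfun_approx.
have mge n r : measurable (g n @^-1` [set r]) by [].
have Hg n : measurable_fun setT (fun y => \int[mu]_(x in D y) (g n x)%:E) /\
    \int[la]_y (\int[mu]_(x in D y) (g n x)%:E) =
    \int[nu]_(x in Omega) ((g n x)%:E * (j x)%:E).
  have IE y := integral_nnsfun_fsum mu (g n) (mD y).
  split.
    under eq_fun do rewrite IE.
    apply: emeasurable_fsum => // r; apply: measurable_funeM; exact: (H _ (mge n r)).1.
  under eq_integral do rewrite IE.
  rewrite ge0_integral_fsum//; last 2 first.
  - by move=> r; apply: measurable_funeM; exact: (H _ (mge n r)).1.
  - move=> r y _; have [r0|r0] := leP 0%R r; first by rewrite mule_ge0 ?lee_fin.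
    by rewrite preimage_nnfun0// set0I measure0 mule0.
  rewrite (integral_nnsfun_density_fsum _ _ _ mj)//; apply: eq_fsbigr => r; rewrite inE => -[t _ <-].
  rewrite ge0_integralZl//; last exact: (H _ (mge n _)).1.
  by rewrite (H _ (mge n _)).2.
have If y : \int[mu]_(x in D y) (g n x)%:E @[n --> \oo] --> \int[mu]_(x in D y) f x.
  rewrite (_ : (fun x => f x) = fun x => limn (fun n => (g n x)%:E)); last first.
    by apply/funext => x; apply/esym/cvg_lim => //; exact: gf.
  apply: cvg_monotone_convergence => // n; exact: measurable_funS (mg n).
have mI : measurable_fun setT (fun y => \int[mu]_(x in D y) f x).
  apply: (emeasurable_fun_cvg (fun n y => \int[mu]_(x in D y) (g n x)%:E)) => //.
  by move=> n; exact: (Hg n).1.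
split=> //.
have -> : (fun y => \int[mu]_(x in D y) f x) =
    fun y => limn (fun n => \int[mu]_(x in D y) (g n x)%:E).
  by apply/funext => y; apply/esym/cvg_lim.
rewrite monotone_convergence//; last 3 first.
- by move=> n; exact: (Hg n).1.
- by move=> n y _; apply: integral_ge0 => x _.
- move=> y _ a b ab; apply: ge0_le_integral => //.
  + exact: measurable_funS (mg a).
  + exact: measurable_funS (mg b).
  + by move=> x _; exact: ndg.
under eq_fun do rewrite (Hg _).2.
rewrite -monotone_convergence//; last 3 first.
- move=> n; apply: emeasurable_funM; last exact: measurable_funS mj.
  exact: measurable_funS (mg n).
- by move=> n x _; apply: mule_ge0 => //; rewrite lee_fin.
- by move=> x _ a b ab; apply: lee_wpmul2r; [rewrite lee_fin|exact: ndg].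
apply: eq_integral => x _; apply/cvg_lim => //.
by apply: cvgeZr => //; exact: gf.
Qed.

End disintegration.

(** * Completed measures *)

Section completion.
Context d (T : measurableType d) (R : realType) (mu : {measure set T -> \bar R}).
Local Open Scope ereal_scope.

Let cT := caratheodory_type (mu^*)%mu.
Let cmu : {measure set cT -> \bar R} := @completed_measure_extension _ T R mu.

(** Intersect countably many covers by measurable sets whose total measures approach
    the outer measure of [X]. *)
Lemma measurable_hull (X : set T) :
  exists F : set T, [/\ measurable F, X `<=` F & mu F <= (mu^*)%mu X].
Proof.
set S := [set \sum_(k <oo) mu (A k) | A in measurable_cover X].
have S0 : S != set0.
  apply/set0P; exists (\sum_(k <oo) mu setT); exists (fun=> setT) => //.
  by split => // x _; exists 0%N.
have [u uS cu] := ereal_inf_seq S0.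
have /choice[A HA] : forall i, exists A : (set T)^nat,
    measurable_cover X A /\ \sum_(k <oo) mu (A k) = u i.
  by move=> i; have [A XA <-] := uS i; exists A.
have mA i k : measurable (A i k) by have [[]] := HA i.
exists (\bigcap_i \bigcup_k A i k); split.
- by apply: bigcapT_measurable => i; exact: bigcupT_measurable.
- by move=> x Xx i _; have [[_ +] _] := HA i; exact.
- have -> : (mu^*)%mu X = lim (u @ \oo) by rewrite (cvg_lim _ cu).
  apply: lime_ge; first by apply/cvg_ex; exists (ereal_inf S).
  apply: nearW => i; have [[_ XA] <-] := HA i.
  apply: (@le_trans _ _ (mu (\bigcup_k A i k))).
    apply: le_measure; rewrite ?inE.
    + by apply: bigcapT_measurable => j; exact: bigcupT_measurable.
    + exact: bigcupT_measurable.
    + by move=> x; exact.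
  by apply: measure_sigma_subadditive => //; exact: bigcupT_measurable.
Qed.

(** [F] is a measurable hull of [E]; finiteness of the measure of [E] makes [F] minus
    [E] null, and [N] is a measurable hull of that difference. *)
Lemma measurable_completion_finite (E : set cT) : measurable E -> cmu E < +oo ->
  exists F N : set T, [/\ measurable F, measurable N, mu N = 0 & E `\` N = F `\` N].
Proof.
move=> mE Eoo; have [F [mF EF muF]] := measurable_hull E.
have [N [mN FN muN]] := measurable_hull (F `\` E).
have Efin : cmu E \is a fin_num by rewrite ge0_fin_numE// (mu_ext_ge0 (measure_ge0 mu)).
have FE0 : (mu^*)%mu (F `\` E) = 0.
  have FE : (mu^*)%mu F = cmu E + (mu^*)%mu (F `\` E).
    by rewrite (mE F) (setIidr EF).
  have : cmu E + (mu^*)%mu (F `\` E) <= cmu E + 0.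
    by rewrite -FE adde0 measurable_mu_extE.
  rewrite leeD2lE// => FE_le0; apply/eqP; rewrite eq_le FE_le0/=.
  exact: (mu_ext_ge0 (measure_ge0 mu)).
exists F, N; split => //.
  by apply/eqP; rewrite eq_le measure_ge0 andbT -FE0.
apply/seteqP; split => x [Ex nNx]; split => //; first exact: EF.
by apply: contrapT => nEx; apply: nNx; apply: FN.
Qed.

Lemma measurable_completion (E : set cT) : sigma_finite setT mu -> measurable E ->
  exists F N : set T, [/\ measurable F, measurable N, mu N = 0 & E `\` N = F `\` N].
Proof.
move=> [S ST mS] mE.
have mcS i : measurable (S i : set cT).
  by apply: caratheodory_measurable_mu_ext; exact: (mS i).1.
have fin i : cmu (E `&` S i) < +oo.
  apply: (@le_lt_trans _ _ ((mu^*)%mu (S i))); first by apply: le_mu_ext; exact: subIsetr.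
  by rewrite measurable_mu_extE; [exact: (mS i).2|exact: (mS i).1].
have H i := measurable_completion_finite (measurableI _ _ mE (mcS i)) (fin i).
have [F /choice[N HFN]] := choice H.
exists (\bigcup_i F i), (\bigcup_i N i); split.
- by apply: bigcupT_measurable => i; have [] := HFN i.
- by apply: bigcupT_measurable => i; have [] := HFN i.
- apply/eqP; rewrite eq_le measure_ge0 andbT.
  have mN i : measurable (N i) by have [] := HFN i.
  apply: (@le_trans _ _ (\sum_(i <oo) mu (N i))).
    by apply: measure_sigma_subadditive => //; exact: bigcupT_measurable.
  by rewrite eseries0// => i _ _; have [] := HFN i.
- apply/seteqP; split => x [].
    move=> Ex nN; split => //; have : (\bigcup_i S i) x by rewrite -ST.
    move=> [i _ Sx]; exists i => //.
    have [_ _ _ EF] := HFN i.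
    have : ((E `&` S i) `\` N i) x by split => // Nx; apply: nN; exists i.
    by rewrite EF => -[].
  move=> [i _ Fx] nN; split => //.
  have [_ _ _ EF] := HFN i.
  have : (F i `\` N i) x by split => // Nx; apply: nN; exists i.
  by rewrite -EF => -[[]].
Qed.

(** The sublevel sets of [p] at rational heights differ from sets of the original
    sigma-algebra by null sets, and the union of these countably many null sets is
    null. *)
Lemma measurable_fun_completion (D : set T) (p : cT -> R) :
  sigma_finite setT mu -> measurable D -> measurable_fun (D : set cT) p ->
  exists N : set T, [/\ measurable N, mu N = 0 &
    measurable_fun (D `\` N) (p : T -> R)].
Proof.
move=> smu mD mp.
have mcD : measurable (D : set cT) by exact: caratheodory_measurable_mu_ext.
(* an enumeration of the rationals; indices that code nothing give 0 *)
pose q i : R := if unpickle i is Some r then ratr (r : rat) else 0%R.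
have mE i : measurable (D `&` p @^-1` [set x | (x < q i)%R] : set cT).
  apply: mp => //; rewrite (_ : [set x | _] = [set` `]-oo, q i[%R]).
    exact: measurable_itv.
  by apply/funext => x; rewrite /= in_itv.
have [F /choice[N HFN]] := choice (fun i => measurable_completion smu (mE i)).
have mN i : measurable (N i) by have [] := HFN i.
have mUN : measurable (\bigcup_i N i) by exact: bigcupT_measurable.
exists (\bigcup_i N i); split => //.
  apply/eqP; rewrite eq_le measure_ge0 andbT.
  apply: (@le_trans _ _ (\sum_(i <oo) mu (N i))).
    exact: measure_sigma_subadditive.
  by rewrite eseries0// => i _ _; have [] := HFN i.
apply: (measurability _ (RGenInftyO.measurableE R)) => _ [_ [a ->] <-].
rewrite (_ : _ `&` _ = \bigcup_(i in [set i | (q i < a)%R]) (F i `\` \bigcup_i N i)).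
  apply: bigcup_measurable => i _; apply: measurableD => //.
  by have [] := HFN i.
apply/seteqP; split => x.
  move=> [[Dx nN]]; rewrite /= in_itv/= => /rat_in_itvoo[r].
  rewrite in_itv/= => /andP[pr ra].
  have qr : q (pickle r) = ratr r by rewrite /q pickleK.
  exists (pickle r); first by rewrite /= qr.
  split => //; have [_ _ _ EF] := HFN (pickle r).
  have : (F (pickle r) `\` N (pickle r)) x.
    rewrite -EF; split; first by split => //=; rewrite qr.
    by move=> Nx; apply: nN; exists (pickle r).
  by case.
move=> [i /= qa [Fx nN]]; have [_ _ _ EF] := HFN i.
have : (F i `\` N i) x by split => // Nx; apply: nN; exists i.
rewrite -EF => -[[Dx /= pq] _]; split; first by split.
by rewrite /= in_itv/= (lt_trans pq).
Qed.

Lemma measurable_fun_completion_id :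
  measurable_fun setT (id : cT -> T).
Proof. by move=> _ A mA; rewrite setTI; exact: caratheodory_measurable_mu_ext. Qed.

Lemma measurable_fun_to_completion d' (Y : measurableType d') (D : set T) (f : T -> Y) :
  measurable D -> measurable_fun D f -> measurable_fun (D : set cT) (f : cT -> Y).
Proof. by move=> mD mf _ B mB; apply: caratheodory_measurable_mu_ext; exact: mf. Qed.

Lemma integral_completion (D : set T) (f : T -> \bar R) :
  measurable D -> measurable_fun D f -> (forall x, D x -> 0 <= f x) ->
  \int[cmu]_(x in D) f x = \int[mu]_(x in D) f x.
Proof.
move=> mD mf f0.
have f0' : {in D, forall y, 0 <= f y} by move=> y /[!inE]; exact: f0.
have := ge0_integral_pushforward measurable_fun_completion_id
  cmu mD mf f0'.
rewrite preimage_id => <-.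
apply: (@eq_measure_integral _ _ _ _ mu
  (pushforward_measure cmu measurable_fun_completion_id)).
by move=> A mA _; exact: measurable_mu_extE.
Qed.

Lemma completed_measure_is_complete :
  measure_is_complete cmu.
Proof. exact: measure_is_complete_caratheodory. Qed.

End completion.

(** Completeness provides the measurability of [g]. *)
Lemma integral_eq_off_null d (T : measurableType d) (R : realType)
    (mu : {measure set T -> \bar R}) (D N : set T) (f g : T -> \bar R) :
  measure_is_complete mu -> measurable D -> measurable_fun D f ->
  (forall x, D x -> 0 <= f x)%E -> (forall x, D x -> 0 <= g x)%E ->
  measurable N -> mu N = 0%E -> (forall x, D x -> ~ N x -> f x = g x) ->
  measurable_fun D g /\ (\int[mu]_(x in D) f x = \int[mu]_(x in D) g x)%E.
Proof.
move=> cmu mD mf f0 g0 mN N0 fg.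
have ae : ae_eq mu D f g.
  exists N; split => // x /= /not_implyP[Dx nfg].
  by apply: contrapT => nNx; apply: nfg; exact: fg.
have mg : measurable_fun D g by exact: (ae_measurable_fun cmu ae).
by split => //; exact: ge0_ae_eq_integral.
Qed.

(** * The coarea formula for functions *)

Section coarea_formula.
Variables (R : realType) (m k : nat) (h : 'rV[R]_(m + k) -> 'rV[R]_m).
Variable Omega : set 'rV[R]_(m + k).
Hypotheses (hC1 : continuously_differentiable h) (oO : open Omega).
Hypothesis j_gt0 : forall x, Omega x -> 0 < jfactor h x.
Local Open Scope ereal_scope.

Let d := (m + k)%N.

Let Hk := @hausdorff_measure R d k.

Lemma hausdorff_measure_complete n l :
  measure_is_complete (@hausdorff_measure R n l).
Proof. exact: measure_is_complete_caratheodory. Qed.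

Lemma integral_hausdorff_borel (D : set (borelRV R d)) (f : borelRV R d -> \bar R) :
  measurable D -> measurable_fun D f -> (forall x, D x -> 0 <= f x) ->
  \int[hausdorff_borel R d k]_(x in D) f x = \int[Hk]_(x in D) f x.
Proof.
move=> mD mf f0.
have f0' : {in D, forall y, 0 <= f y} by move=> y /[!inE]; exact: f0.
exact: (ge0_integral_pushforward (@measurable_id_hausdorff_borel R d k) Hk mD mf f0').
Qed.

Lemma coarea_borel_fun (E : set (borelRV R d)) (f : borelRV R d -> \bar R) :
  measurable E -> E `<=` Omega -> measurable_fun setT f -> (forall x, 0 <= f x) ->
  measurable_fun setT ((fun y => \int[Hk]_(x in E `&` h @^-1` [set y]) f x)
    : borelRV R m -> \bar R) /\
  \int[@leb R m]_y (\int[Hk]_(x in E `&` h @^-1` [set y]) f x) =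
  \int[@leb R d]_(x in E) (f x * (jfactor h x)%:E).
Proof.
move=> mE EO mf f0.
have mEy (y : borelRV R m) : measurable (E `&` h @^-1` [set y] : set (borelRV R d)).
  by apply: measurableI => //; exact: measurable_fibre.
have mj : measurable_fun (setT : set (borelRV R d)) (EFin \o jfactor h).
  exact: measurable_jfactor.
have [] := @ge0_integral_disintegration _ _ _ (borelRV R m) R (hausdorff_borel R d k) (@leb R d)
  (@leb R m) (fun y => E `&` h @^-1` [set y]) E (jfactor h) f mEy mE mj
  (@jfactor_ge0 R d m h) mf f0.
  move=> B mB.
  have [] := coarea_borel_set hC1 oO j_gt0 (measurableI _ _ mB mE) (subset_trans (@subIsetr _ _ _) EO).
  have BE y : B `&` (E `&` h @^-1` [set y]) = B `&` E `&` h @^-1` [set y].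
    by rewrite setIA.
  move=> mF IF; split; first by under eq_fun do rewrite BE.
  by rewrite -IF; apply: eq_integral => y _; rewrite BE.
have IE (y : borelRV R m) : \int[hausdorff_borel R d k]_(x in E `&` h @^-1` [set y]) f x =
    \int[Hk]_(x in E `&` h @^-1` [set y]) f x.
  by apply: integral_hausdorff_borel => //; exact: measurable_funS mf.
by under eq_fun do rewrite IE.
Qed.

Let fibreI (A : set (borelRV R m)) y :
  (Omega `&` h @^-1` A) `&` h @^-1` [set y] = if y \in A then Omega `&` h @^-1` [set y] else set0.
Proof.
case: ifPn => yA; apply/seteqP; split => x //=.
- by move=> [[]].
- by move=> [Ox hx]; split => //; split => //=; rewrite hx; exact: set_mem.
- by move=> [[_ Ahx] hx]; move/negP: yA; apply; rewrite -hx; exact: mem_set.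
Qed.

(** Restricting the integral to [A] amounts to replacing the domain by its part above
    [A], all of whose fibres outside [A] are empty. *)
Lemma coarea_borel_fun_in (A : set (borelRV R m)) (f : borelRV R d -> \bar R) :
  measurable A -> measurable_fun setT f -> (forall x, 0 <= f x) ->
  \int[@leb R m]_(y in A) (\int[Hk]_(x in Omega `&` h @^-1` [set y]) f x) =
  \int[@leb R d]_(x in Omega `&` h @^-1` A) (f x * (jfactor h x)%:E).
Proof.
move=> mA mf f0.
have mE : measurable (Omega `&` h @^-1` A : set (borelRV R d)).
  by apply: measurableI; [exact: open_borel|exact: measurable_preimage_C1].
have [_ <-] := coarea_borel_fun mE (@subIsetl _ _ _) mf f0.
rewrite integral_mkcond; apply: eq_integral => y _.
by rewrite fibreI patchE; case: ifPn; rewrite ?integral_set0.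
Qed.

Lemma coarea_borel_set_in (A : set (borelRV R m)) : measurable A ->
  \int[@leb R m]_(y in A) hausdorff k (Omega `&` h @^-1` [set y]) =
  \int[@leb R d]_(x in Omega `&` h @^-1` A) (jfactor h x)%:E.
Proof.
move=> mA.
have mE : measurable (Omega `&` h @^-1` A : set (borelRV R d)).
  by apply: measurableI; [exact: open_borel|exact: measurable_preimage_C1].
have [_ <-] := coarea_borel_set hC1 oO j_gt0 mE (@subIsetl _ _ _).
rewrite integral_mkcond; apply: eq_integral => y _.
by rewrite fibreI patchE; case: ifPn => // _; rewrite outer_measure0.
Qed.

(** The coarea formula for the null set: the integral of the measures of its fibres
    vanishes. *)
Lemma null_set_fibres (N : set (borelRV R d)) : measurable N -> leb N = 0 ->
  exists Z : set (borelRV R m), [/\ measurable Z, leb Z = 0 &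
    forall y, ~ Z y -> hausdorff k (N `&` Omega `&` h @^-1` [set y]) = 0].
Proof.
move=> mN N0.
have mNO : measurable (N `&` Omega : set (borelRV R d)).
  by apply: measurableI => //; exact: open_borel.
have [mF IF] := coarea_borel_set hC1 oO j_gt0 mNO (@subIsetr _ _ _).
have NO0 : leb (N `&` Omega : set (borelRV R d)) = 0.
  by apply: (subset_measure0 (mu := @leb R d) mNO mN) => // x [].
have /integral_abs_eq0 := NO0.
move=> /(_ (EFin \o jfactor h) mNO (@measurable_jfactor _ _ _ h _ hC1)) J0.
have I0 : \int[@leb R m]_y `| hausdorff k (N `&` Omega `&` h @^-1` [set y]) | = 0.
  under eq_integral do rewrite gee0_abs ?outer_measure_ge0//.
  rewrite IF -[RHS]J0; apply: eq_integral => x _.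
  by rewrite /= ger0_norm// jfactor_ge0.
have := ae_eq_integral_abs (@leb R m) measurableT mF => -[+ _].
move=> /(_ I0)[Z [mZ Z0 HZ]]; exists Z; split => // y nZ.
by apply: contrapT => Hy; apply: nZ; apply: HZ => /= /(_ I).
Qed.

End coarea_formula.

(** * The pushforward density *)

Section fiber_integrals.
Variables (R : realType) (m k : nat) (h : 'rV[R]_(m + k) -> 'rV[R]_m).
Variable Omega : set 'rV[R]_(m + k).
Hypotheses (hC1 : continuously_differentiable h) (oO : open Omega).
Hypothesis j_gt0 : forall x, Omega x -> 0 < jfactor h x.
Local Open Scope ereal_scope.

Let d := (m + k)%N.

Let Hk := @hausdorff_measure R d k.

Lemma measurable_fiber_hausdorff :
  measurable_fun setT ((fun y => Hk (Omega `&` h @^-1` [set y])) : lebesgueRV R m -> \bar R).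
Proof.
have [mF _] := coarea_borel_set hC1 oO j_gt0 (open_borel oO) (@subset_refl _ _).
exact: (@measurable_fun_to_completion _ _ _ (borel_lebesgue R m)) measurableT mF.
Qed.

Lemma integral_fiber_hausdorff (A : set (borelRV R m)) : measurable A ->
  \int[lebesgue_rV R m]_(y in A) Hk (Omega `&` h @^-1` [set y]) =
  \int[lebesgue_rV R d]_(x in Omega `&` h @^-1` A) (jfactor h x)%:E.
Proof.
move=> mA.
have [mF _] := coarea_borel_set hC1 oO j_gt0 (open_borel oO) (@subset_refl _ _).
have mE : measurable (Omega `&` h @^-1` A : set (borelRV R d)).
  by apply: measurableI; [exact: open_borel|exact: measurable_preimage_C1].
have mj : measurable_fun (Omega `&` h @^-1` A : set (borelRV R d)) (EFin \o jfactor h).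
  exact: measurable_jfactor.
transitivity (\int[@leb R m]_(y in A) hausdorff k (Omega `&` h @^-1` [set y])).
  apply: (@integral_completion _ _ _ (borel_lebesgue R m)) => //.
  exact: measurable_funS mF.
rewrite coarea_borel_set_in//; apply/esym.
apply: (@integral_completion _ _ _ (borel_lebesgue R d)) => //.
by move=> x _; rewrite lee_fin jfactor_ge0.
Qed.

Variable p : lebesgueRV R d -> R.
Hypothesis p_ge0 : forall x, Omega x -> (0 <= p x)%R.
Hypothesis p_meas : measurable_fun (Omega : set (lebesgueRV R d)) p.

Let v (y : lebesgueRV R m) := \int[Hk]_(x in Omega `&` h @^-1` [set y]) (p x / jfactor h x)%:E.

Let borel_representative : exists (N : set (borelRV R d)) (f : borelRV R d -> \bar R),
  [/\ measurable N, leb N = 0, measurable_fun setT f, (forall x, 0 <= f x) &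
      forall x, Omega x -> ~ N x -> f x = (p x / jfactor h x)%:E].
Proof.
have [N [mN N0 mp]] := measurable_fun_completion (leb_sigma_finite R d) (open_borel oO) p_meas.
pose g := fun x : borelRV R d => (p x / jfactor h x)%:E.
have mON : measurable (Omega `\` N : set (borelRV R d)).
  by apply: measurableD => //; exact: open_borel.
(* p / j is set to 0 where its measurability or sign is not controlled *)
exists N, (g \_ (Omega `\` N)); split => //.
- apply/(measurable_restrict _ mON measurableT); rewrite setTI.
  apply/measurable_EFinP; apply: measurable_funM => //.
  have -> : (fun x => (jfactor h x)^-1)%R = (fun t => powR t (-1)) \o jfactor h.
    by apply/funext => x; rewrite /= powR_inv1 ?jfactor_ge0.
  apply: measurableT_comp; first exact: measurable_powR.
  by apply/measurable_EFinP; exact: measurable_jfactor.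
- move=> x; rewrite patchE; case: ifPn => // /set_mem[Ox _].
  by rewrite lee_fin divr_ge0 ?jfactor_ge0 ?p_ge0.
- by move=> x Ox nNx; rewrite patchE mem_set.
Qed.

(** Replace [p / j] by a nonnegative Borel function [f] that agrees with it off a null
    set [N].  For almost every [y] the fibre integrals of the two functions agree, and
    on the total space they agree almost everywhere, so that the coarea formula for
    [f] carries over to [p / j], where [(p / j) * j = p]. *)
Lemma fiber_integral_measurable_coarea :
  measurable_fun setT v /\
  forall A : set (borelRV R m), measurable A ->
    \int[lebesgue_rV R m]_(y in A) v y =
    \int[lebesgue_rV R d]_(x in Omega `&` h @^-1` A) (p x)%:E.
Proof.
have [N [f [mN N0 mf f0 fE]]] := borel_representative.
have [Z [mZ Z0 HZ]] := null_set_fibres hC1 oO j_gt0 mN N0.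
pose w y := \int[Hk]_(x in Omega `&` h @^-1` [set y]) f x.
have mO : measurable (Omega : set (borelRV R d)) by exact: open_borel.
have mOy y : measurable (Omega `&` h @^-1` [set y] : set (borelRV R d)).
  by apply: measurableI => //; exact: measurable_fibre.
have q0 x : Omega x -> 0 <= (p x / jfactor h x)%:E.
  by move=> Ox; rewrite lee_fin divr_ge0 ?jfactor_ge0 ?p_ge0.
have vw y : ~ Z y -> v y = w y.
  move=> nZ; rewrite /v /w.
  have mHf : measurable_fun (Omega `&` h @^-1` [set y] : set (hausdorffRV R d k)) f.
    by move=> _ B mB; apply: borel_hausdorff_measurable; exact: (measurable_funS measurableT _ mf).
  apply/esym; refine (integral_eq_off_null (mu := Hk)
    (N := N `&` Omega `&` h @^-1` [set y]) _ _ mHf _ _ _ _ _).2.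
  - exact: hausdorff_measure_complete.
  - exact: borel_hausdorff_measurable.
  - by move=> x _; exact: f0.
  - by move=> x [Ox _]; exact: q0.
  - apply: borel_hausdorff_measurable.
    by apply: measurableI; [exact: measurableI|exact: measurable_fibre].
  - exact: HZ.
  - by move=> x [Ox hx] nE; apply: fE => // Nx; apply: nE.
have [mw _] := coarea_borel_fun hC1 oO j_gt0 mO (@subset_refl _ _) mf f0.
have mwc : measurable_fun (setT : set (lebesgueRV R m)) w.
  exact: (@measurable_fun_to_completion _ _ _ (borel_lebesgue R m)) measurableT mw.
have mcZ : measurable (Z : set (lebesgueRV R m)) by exact: caratheodory_measurable_mu_ext.
have cZ0 : lebesgue_rV R m Z = 0 by rewrite -Z0; exact: measurable_mu_extE.
have w0 y : 0 <= w y by apply: integral_ge0.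
have v0 y : 0 <= v y by apply: integral_ge0 => x [Ox _]; exact: q0.
have wv (D : set (lebesgueRV R m)) : measurable D ->
    measurable_fun D v /\ \int[lebesgue_rV R m]_(y in D) w y = \int[lebesgue_rV R m]_(y in D) v y.
  move=> mD; apply: (integral_eq_off_null (mu := lebesgue_rV R m) (N := Z)) => //.
  - exact: (@completed_measure_is_complete _ _ _ (borel_lebesgue R m)).
  - exact: measurable_funS mwc.
  - by move=> y _ /vw.
split; first by have [] := wv _ measurableT.
move=> A mA.
have mcA : measurable (A : set (lebesgueRV R m)) by exact: caratheodory_measurable_mu_ext.
have mE : measurable (Omega `&` h @^-1` A : set (borelRV R d)).
  by apply: measurableI; [exact: open_borel|exact: measurable_preimage_C1].
have mcE : measurable (Omega `&` h @^-1` A : set (lebesgueRV R d)).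
  exact: caratheodory_measurable_mu_ext.
have mcN : measurable (N : set (lebesgueRV R d)) by exact: caratheodory_measurable_mu_ext.
have cN0 : lebesgue_rV R d N = 0 by rewrite -N0; exact: measurable_mu_extE.
rewrite -(wv _ mcA).2.
transitivity (\int[@leb R m]_(y in A) w y).
  apply: (@integral_completion _ _ _ (borel_lebesgue R m)) => //.
  exact: measurable_funS mw.
rewrite coarea_borel_fun_in//.
have mfj : measurable_fun (Omega `&` h @^-1` A : set (borelRV R d))
    (fun x => f x * (jfactor h x)%:E).
  by apply: emeasurable_funM; [exact: measurable_funS mf|exact: measurable_jfactor].
transitivity (\int[lebesgue_rV R d]_(x in Omega `&` h @^-1` A) (f x * (jfactor h x)%:E)).
  apply/esym; apply: (@integral_completion _ _ _ (borel_lebesgue R d)) => //.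
  by move=> x _; rewrite mule_ge0// lee_fin jfactor_ge0.
refine (integral_eq_off_null (mu := lebesgue_rV R d) (N := N) _ mcE _ _ _ mcN cN0 _).2.
- exact: (@completed_measure_is_complete _ _ _ (borel_lebesgue R d)).
- exact: (@measurable_fun_to_completion _ _ _ (borel_lebesgue R d)) mE mfj.
- by move=> x _; rewrite mule_ge0// lee_fin jfactor_ge0.
- by move=> x [Ox _]; rewrite lee_fin p_ge0.
- move=> x [Ox _] nN; rewrite fE// -EFinM divfK//.
  by rewrite gt_eqF// j_gt0.
Qed.

End fiber_integrals.

Theorem proposition3p2 (R : realType) (d m : nat) (hmd : (m <= d)%N)
    (Omega : set 'rV[R]_d) (openOmega : open Omega)
    (h : 'rV[R]_d -> 'rV[R]_m)
    (h_C1 : continuously_differentiable h) (h_lip : lipschitz h)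
    (j_gt0 : forall x, Omega x -> 0 < jfactor h x) :
  (forall (P : {finite_measure set (borelRV R d) -> \bar R})
      (p : lebesgueRV R d -> R)
      (p_ge0 : forall x, Omega x -> 0 <= p x)
      (p_meas : measurable_fun (Omega : set (lebesgueRV R d)) p)
      (P_density : forall B : set (borelRV R d), measurable B -> B `<=` Omega ->
         P B = (\int[lebesgue_rV R d]_(x in B) (p x)%:E)%E),
    measurable_fun setT
      (fiber_density Omega h p : lebesgueRV R m -> \bar R) /\
    forall A : set (borelRV R m), measurable A ->
      (\int[lebesgue_rV R m]_(y in A) fiber_density Omega h p y)%E =
      P (Omega `&` h @^-1` A)) /\
  ((\int[lebesgue_rV R d]_(x in Omega) (jfactor h x)%:E < +oo)%E ->
    measurable_fun setT
      ((fun y => @hausdorff_measure R d (d - m) (Omega `&` h @^-1` [set y]))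
        : lebesgueRV R m -> \bar R) /\
    forall A : set (borelRV R m), measurable A ->
      (\int[lebesgue_rV R m]_(y in A)
         @hausdorff_measure R d (d - m) (Omega `&` h @^-1` [set y]))%E =
      (\int[lebesgue_rV R d]_(x in Omega `&` h @^-1` A) (jfactor h x)%:E)%E).
Proof.
have [k dE] : exists k, d = (m + k)%N by exists (d - m)%N; rewrite subnKC.
subst d; clear h_lip hmd; rewrite /fiber_density addKn; split.
- move=> P p p_ge0 p_meas P_density.
  have [mv Iv] := fiber_integral_measurable_coarea h_C1 openOmega j_gt0 p_ge0 p_meas.
  split => // A mA; rewrite Iv// P_density//.
  by apply: measurableI; [exact: open_borel|exact: measurable_preimage_C1].
- move=> _; split; first exact: measurable_fiber_hausdorff.
  by move=> A mA; exact: integral_fiber_hausdorff.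
Qed.
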